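(* Let $n\ge2$, let $G\subset GL(\mathbb C)$ be the cyclic group generated by $z\mapsto e^{2\pi i/n}z$, so that $Z=\mathbb C$ and $\pi(z)=z^n$. Let $f:(\mathbb C^p,0)\to\mathbb C$ be a germ of a holomorphic function. Then $f$ has a local lift at $0$ (a holomorphic germ $F$ with $F^n=f$) if and only if either $f=0$, or there is a system of indices $(a_1,\dots,a_r)$, $a_k\in\{1,\dots,p\}$, such that, with $A=(a_1,\dots,a_r)$, the functions $f^1_A$ and $f^n_A$ (defined on $\{f\ne0\}$) have holomorphic extensions to a neighborhood of $0$ and $f^n_A(0)\ne0$.
   Context: For a holomorphic germ $f$ on a neighborhood of $0\in\mathbb C^p$ and a multi-index $A=(a_1,\dots,a_r)$ with $\partial_A=\partial^r/\partial x_{a_1}\cdots\partial x_{a_r}$, define on the open set $\{x:f(x)\ne0\}$ the functions $f^1_A:=F^{\,n-1}\partial_AF$ and $f^n_A:=(\partial_AF)^n$, where $F$ is any local holomorphic branch of $f^{1/n}$ (these do not depend on the choice of branch). (In the paper's notation these are $f^1_{a_1\dots a_r}\circ j^rf$ and $f^n_{a_1\dots a_r,\dots,a_1\dots a_r}\circ j^rf$.) *)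

(* Defs.v *)
(* The complex numbers are R[i] = complex R for R : realType (mathcomp-real-closed);
   (R[i])^o is R[i] viewed as a normed module over itself, so that 'D and
   differentiable below are COMPLEX derivatives / complex Frechet differentiability. *)
From HB Require Import structures.
From mathcomp Require Import all_boot all_order all_algebra.
From mathcomp Require Import complex.
From mathcomp Require Import all_classical all_reals all_analysis.
Set Implicit Arguments. Unset Strict Implicit. Unset Printing Implicit Defensive.
Import Order.TTheory GRing.Theory Num.Theory.
Import numFieldNormedType.Exports.
Local Open Scope ring_scope.
Local Open Scope complex_scope.

Definition cpartial (R : realType) (p : nat) (a : 'I_p)
    (F : 'rV[R[i]^o]_p -> (R[i])^o) : 'rV[R[i]^o]_p -> (R[i])^o :=
  fun x => 'D_('e_a) F x.

Definition cpartialA (R : realType) (p : nat) (A : seq 'I_p)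
    (F : 'rV[R[i]^o]_p -> (R[i])^o) : 'rV[R[i]^o]_p -> (R[i])^o :=
  foldr (@cpartial R p) F A.

Definition local_branch (R : realType) (p n : nat)
    (f F : 'rV[R[i]^o]_p -> (R[i])^o) (x : 'rV[R[i]^o]_p) : Prop :=
  \forall y \near x, differentiable F y /\ F y ^+ n = f y.

Definition f1A (R : realType) (p n : nat) (A : seq 'I_p)
    (F : 'rV[R[i]^o]_p -> (R[i])^o) (x : 'rV[R[i]^o]_p) : R[i] :=
  F x ^+ n.-1 * cpartialA A F x.

Definition fnA (R : realType) (p n : nat) (A : seq 'I_p)
    (F : 'rV[R[i]^o]_p -> (R[i])^o) (x : 'rV[R[i]^o]_p) : R[i] :=
  cpartialA A F x ^+ n.

(* g is a holomorphic extension, to a neighborhood of 0, of the function h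
   defined on {f <> 0} via local branches F of f^(1/n):
   near 0, g is holomorphic and, at every x with f x <> 0,
   g x = h F x for every local branch F of f^(1/n) at x
   (h F x does not depend on the branch). *)
Definition holo_ext_at0 (R : realType) (p n : nat)
    (f : 'rV[R[i]^o]_p -> (R[i])^o)
    (h : ('rV[R[i]^o]_p -> (R[i])^o) -> 'rV[R[i]^o]_p -> R[i])
    (g : 'rV[R[i]^o]_p -> (R[i])^o) : Prop :=
  \forall x \near (0 : 'rV[R[i]^o]_p),
    differentiable g x /\
    (f x != 0 -> forall F, local_branch n f F x -> g x = h F x).

(* Main.v *)
Require Import Defs.
From HB Require Import structures.
From mathcomp Require Import all_boot all_order all_algebra.
From mathcomp Require Import complex.
From mathcomp Require Import all_classical all_reals all_analysis.
From mathcomp Require Import ring lra.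
Set Implicit Arguments. Unset Strict Implicit. Unset Printing Implicit Defensive.
Import Order.TTheory GRing.Theory Num.Theory.
Import numFieldNormedType.Exports.
Import ComplexField.Normc.
Local Open Scope ring_scope.
Local Open Scope complex_scope.
Local Open Scope classical_set_scope.
Local Notation Re := complex.Re.
Local Notation Im := complex.Im.

(**
  If f = F^n with F not identically zero, then by the identity theorem some
  iterated partial derivative of F is nonzero at 0; since two branches of
  f^(1/n) near a point where f does not vanish differ by a constant n-th root
  of unity, F^(n-1) d_A F and (d_A F)^n are the required extensions.
  Conversely, with extensions g1 and gn, let G be a holomorphic n-th root of gn
  near 0 and H := g1 / G.  Then H^n = f^(n-1) wherever f <> 0, so F := f / H
  (which is 0 where f = 0, as division is total) satisfies F^n = f.  It is
  continuous because |F|^n = |f|, and it is holomorphic on every complex line,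
  by comparing the orders of vanishing of f and H there; a continuous function
  that is holomorphic on lines is holomorphic.

  One complex variable is treated by Goursat's lemma on rectangles, which gives
  Cauchy's formula on the square [-1, 1]^2 and Taylor expansions with explicit
  remainders.  Everything in several variables follows from the uniform
  first-order remainder estimate along lines.
*)

(** * Complex moduli as real numbers *)

(** The obstacle is the zero set of [f]: near 0 it may be singular, and a branch of f^(1/n) may
    change by a root of unity around it. The two extensions determine [H], hence F, without
    continuing any branch: if B is a branch at a single point, then g1^n / gn = B^(n(n-1)) (d_A B)^n
    / (d_A B)^n = f^(n-1), and the choice of B cancels. So f / H is a single function near 0, and
    only its regularity at the zeros of [f] is in question. There, complex lines take the place of a
    removable singularity theorem in several variables: along a line the orders k of f and m of H
    are integers with n m = (n-1) k, which forces m < k as soon as k > 0. To return from lines to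
    several variables, Taylor remainders are kept explicit, with constants depending only on a
    radius and a bound, so that they are the same for all lines through a ball. The role of 2 pi i
    is played by the contour integral of 1/w over the square, which only has to be nonzero. *)

Section Modulus.
Variable R : realType.
Implicit Types z w : R[i].

(** The norm on [R[i]] takes its values in [R[i]]; estimates are carried out with the real number
    [normc z] and transferred by this identity. *)
Lemma normrE z : `|z| = (normc z)%:C. Proof. by []. Qed.

Lemma normc_ge0 z : 0 <= normc z.
Proof. by rewrite -lecR -normrE normr_ge0. Qed.

Lemma normc_eq0 z : (normc z == 0) = (z == 0).
Proof. by rewrite -(inj_eq (@complexI R)) -normrE normr_eq0. Qed.

Lemma normc_gt0 z : (0 < normc z) = (z != 0).
Proof. by rewrite lt_def normc_ge0 normc_eq0 andbT. Qed.

Lemma normcX z n : normc (z ^+ n) = normc z ^+ n.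
Proof. by apply: (@complexI R); rewrite -normrE normrX rmorphXn. Qed.

Lemma normcB z w : normc (z - w) = normc (w - z).
Proof. by rewrite -opprB normcN. Qed.

Lemma normc_real (x : R) : normc x%:C = `|x|.
Proof. by rewrite /= expr0n /= addr0 sqrtr_sqr. Qed.

Lemma normc_i : normc ('i : R[i]) = 1.
Proof. by rewrite /= expr0n /= expr1n add0r sqrtr1. Qed.

Lemma normc_Re z : `|Re z| <= normc z.
Proof.
case: z => a b /=; rewrite -sqrtr_sqr ler_wsqrtr// lerDl; exact: sqr_ge0.
Qed.

Lemma normc_Im z : `|Im z| <= normc z.
Proof.
case: z => a b /=; rewrite -sqrtr_sqr ler_wsqrtr// lerDr; exact: sqr_ge0.
Qed.

Lemma normc_le_ReIm z : normc z <= `|Re z| + `|Im z|.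
Proof.
rewrite [z in normc z]complexE; apply: le_trans (le_normcD _ _) _.
by rewrite normcM normc_i mul1r !normc_real.
Qed.

End Modulus.

Section RealRadius.
Variable R : realType.

(** The order of [R[i]] compares only numbers with the same imaginary part, so positive radii and
    tolerances are automatically real. *)
Lemma gt0_complexP (e : R[i]) : 0 < e -> exists2 d : R, 0 < d & e = d%:C.
Proof.
case: e => a b; rewrite ltcE /= => /andP[/eqP -> a0].
by exists a.
Qed.

Lemma nbhs_realP (V : normedModType R[i]) (x : V) (P : set V) :
  nbhs x P <-> exists2 d : R, 0 < d & forall y, `|y - x| < d%:C -> P y.
Proof.
split.
  move=> /nbhs_normP[e /= /gt0_complexP[d d0 ->] H].
  by exists d => // y yx; apply: H; rewrite /= distrC.
move=> [d d0 H]; apply/nbhs_normP; exists d%:C; first by rewrite /= ltcR.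
by move=> y /=; rewrite distrC; exact: H.
Qed.

Lemma cvg_realP (V : normedModType R[i]) (T : Type) (F : set_system T)
    (FF : Filter F) (f : T -> V) (l : V) :
  f x @[x --> F] --> l <->
  (forall e : R, 0 < e -> F [set x | `|f x - l| < e%:C]).
Proof.
split.
  move=> /cvgrPdist_lt H e e0.
  have : 0 < e%:C by rewrite ltcR.
  by move=> /H; apply: filterS => x /=; rewrite distrC.
move=> H; apply/cvgrPdist_lt => _ /gt0_complexP[e e0 ->].
by apply: filterS (H _ e0) => x /=; rewrite distrC.
Qed.

Lemma continuous_realP (V W : normedModType R[i]) (f : V -> W) (x : V) :
  {for x, continuous f} <->
  (forall e : R, 0 < e -> exists2 d : R, 0 < d &
    forall y, `|y - x| < d%:C -> `|f y - f x| < e%:C).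
Proof.
split=> [/(@cvg_realP _ _ _ (nbhs_filter x)) H e /H/nbhs_realP //|H].
by apply/(@cvg_realP _ _ _ (nbhs_filter x)) => e /H ?; apply/nbhs_realP.
Qed.

(* Stated without division, so that no case distinction on h = 0 is needed. *)
Lemma is_derive_realP (V : normedModType R[i]) (f : V -> R[i]^o) (x v : V)
    (l : R[i]) :
  is_derive x v f (l : R[i]^o) <->
  (forall e : R, 0 < e -> exists2 d : R, 0 < d &
    forall h : R[i], normc h < d ->
      normc (f (h *: v + x) - f x - h * l) <= e * normc h).
Proof.
split.
  move=> [dv dl] e e0.
  have : (fun h : R[i]^o => h^-1 *: (f (h *: v + x) - f x)) @ 0^' --> (l : R[i]^o).
    by rewrite -dl; exact: dv.
  move=> /(@cvg_realP _ _ _ _)/(_ e e0).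
  rewrite /dnbhs /within /= => /nbhs_realP[d d0 H]; exists d => // h hd.
  have [->|h0] := eqVneq h 0.
    by rewrite scale0r add0r mul0r subrr subr0 normc0 mulr0.
  have := H h; rewrite subr0 normrE ltcR => /(_ hd h0).
  rewrite normrE ltcR => /ltW Hh.
  rewrite (_ : f _ - _ - _ = h * (h^-1 *: (f (h *: v + x) - f x) - l)); last first.
    by rewrite mulrBr; congr (_ - _); rewrite /GRing.scale /= mulrA mulfV ?mul1r.
  by rewrite normcM mulrC ler_wpM2r // normc_ge0.
move=> H.
have cv : (fun h : R[i]^o => h^-1 *: (f (h *: v + x) - f x)) @ 0^' --> (l : R[i]^o).
  apply/(@cvg_realP _ _ _ _) => e e0.
  have e20 : 0 < e / 2 by rewrite divr_gt0.
  have [d d0 Hd] := H _ e20.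
  rewrite /dnbhs /within /=; apply/nbhs_realP; exists d => // h.
  rewrite subr0 normrE ltcR => hd h0; rewrite normrE ltcR.
  rewrite (_ : _ - l = h^-1 * (f (h *: v + x) - f x - h * l)); last first.
    by rewrite [RHS]mulrBr; congr (_ - _); rewrite mulrA mulVf ?mul1r.
  rewrite normcM normcV.
  have nh0 : 0 < normc h by rewrite normc_gt0.
  rewrite mulrC ltr_pdivrMr //; apply: le_lt_trans (Hd _ hd) _.
  by rewrite ltr_pM2r // ltr_pdivrMr // mulr_natr mulr2n ltrDl.
split; first by apply/cvg_ex; exists l.
exact: cvg_lim.
Qed.

End RealRadius.

(** * Integration of complex-valued functions of a real variable *)

Section RealSide.
Variable R : realType.
Implicit Types (h H : R -> R) (a b : R).
Local Notation mu := (@lebesgue_measure R).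

(** Continuity is two-sided even at the endpoints: the contour integrands are restrictions of
    functions on the plane that are continuous at every point of the contour. *)
Definition rcont h a b := forall t, a <= t <= b -> {for t, continuous h}.

Lemma rcont_within h a b : rcont h a b -> {within `[a, b], continuous h}.
Proof.
move=> ch; apply: continuous_in_subspaceT => t; rewrite inE /= in_itv /=.
exact: ch.
Qed.

Lemma rcont_integrable h a b : rcont h a b -> mu.-integrable `[a, b] (EFin \o h).
Proof.
by move=> ch; apply: continuous_compact_integrable;
  [exact: segment_compact|exact: rcont_within].
Qed.

Lemma rcontS h a b c d : a <= c -> d <= b -> rcont h a b -> rcont h c d.
Proof. by move=> ac db ch t /andP[ct td]; apply: ch; lra. Qed.

Lemma Rintegral_split h a b c : a <= c <= b -> rcont h a b ->
  \int[mu]_(t in `[a, b]) h t =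
  \int[mu]_(t in `[a, c]) h t + \int[mu]_(t in `[c, b]) h t.
Proof.
move=> /andP[ac cb] ch.
have := @Rintegral_itvB R h (BLeft a) (BRight b) c (rcont_integrable ch).
rewrite !bnd_simp => /(_ ac cb) E.
rewrite -(@Rintegral_itv_obnd_cbnd R c (BRight b)).
  by rewrite -E addrC subrK.
apply: (integrableS _ _ _ (rcont_integrable (rcontS ac (lexx b) ch))) => //.
exact: subset_itv_oc_cc.
Qed.

Lemma Rintegral_bound h a b M : a <= b -> rcont h a b ->
  (forall t, a <= t <= b -> `|h t| <= M) ->
  `|\int[mu]_(t in `[a, b]) h t| <= M * (b - a).
Proof.
move=> ab ch hM.
have ih := rcont_integrable ch.
apply: le_trans (le_normr_Rintegral _ ih) _ => //.
have -> : M * (b - a) = \int[mu]_(t in `[a, b]) M.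
  rewrite Rintegral_cst //= lebesgue_measure_itv /= lte_fin.
  by case: ltP => //= ba; rewrite (_ : b = a) ?subrr //; apply/eqP; rewrite eq_le ba ab.
apply: le_Rintegral => //.
- exact: integrable_norm.
- by apply: (rcont_integrable (h := cst M)) => t _; exact: cvg_cst.
Qed.

Lemma Rintegral_FTC h H a b : a < b -> rcont h a b ->
  (forall t, a <= t <= b -> is_derive t 1 H (h t)) ->
  \int[mu]_(t in `[a, b]) h t = H b - H a.
Proof.
move=> ab ch dH.
have cH t : a <= t <= b -> {for t, continuous H}.
  move=> /dH[dt _]; apply: differentiable_continuous; exact/derivable1_diffP.
rewrite /Rintegral (continuous_FTC2 (F := H)) //.
- exact: rcont_within.
- split.
  + by move=> t; rewrite in_itv /= => tab; case: (dH t) => //; lra.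
  + by apply: cvg_at_right_filter; apply: cH; rewrite lexx ltW.
  + by apply: cvg_at_left_filter; apply: cH; rewrite lexx ltW.
- move=> t; rewrite in_itv /= => tab; rewrite derive1E.
  by case: (dH t) => //; lra.
Qed.

Lemma is_derive_eps (f : R -> R) (x l : R) :
  (forall e : R, 0 < e -> exists2 d : R, 0 < d &
    forall h : R, `|h| < d -> `|f (h + x) - f x - h * l| <= e * `|h|) ->
  is_derive x 1 f l.
Proof.
move=> H.
have cv : (fun h : R => h^-1 *: (f (h *: 1 + x) - f x)) @ 0^' --> l.
  apply/cvgrPdist_le => e e0.
  have [d d0 Hd] := H _ e0.
  rewrite /dnbhs /within /=; apply/nbhs_normP; exists d => // h /=.
  rewrite sub0r normrN => hd h0; rewrite distrC.
  rewrite (_ : _ - l = h^-1 * (f (h + x) - f x - h * l)); last first.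
    by rewrite /GRing.scale /= mulr1 [RHS]mulrBr mulrA mulVf ?mul1r.
  rewrite normrM normfV mulrC ler_pdivrMr ?normr_gt0 //; exact: Hd.
split; first by apply/cvg_ex; exists l.
exact: cvg_lim.
Qed.

End RealSide.

Section ComplexIntegral.
Variable R : realType.
Implicit Types (g : R -> R[i]) (a b : R).
Local Notation mu := (@lebesgue_measure R).

Definition ccont g a b := forall t, a <= t <= b ->
  forall e : R, 0 < e -> exists2 d : R, 0 < d &
    forall s, `|s - t| < d -> normc (g s - g t) < e.

Lemma ccont_Re g a b : ccont g a b -> rcont (fun t => Re (g t)) a b.
Proof.
move=> cg t /cg H; apply/(@cvgrPdist_lt _ _ _ _ (nbhs_filter t)) => e /H[d d0 Hd].
apply/nbhs_normP; exists d => // s /=; rewrite distrC => /Hd; apply: le_lt_trans.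
by rewrite distrC (_ : _ - _ = Re (g s - g t)) ?normc_Re //; case: (g s); case: (g t).
Qed.

Lemma ccont_Im g a b : ccont g a b -> rcont (fun t => Im (g t)) a b.
Proof.
move=> cg t /cg H; apply/(@cvgrPdist_lt _ _ _ _ (nbhs_filter t)) => e /H[d d0 Hd].
apply/nbhs_normP; exists d => // s /=; rewrite distrC => /Hd; apply: le_lt_trans.
by rewrite distrC (_ : _ - _ = Im (g s - g t)) ?normc_Im //; case: (g s); case: (g t).
Qed.

Definition cint g a b : R[i] :=
  (\int[mu]_(t in `[a, b]) Re (g t)) +i* (\int[mu]_(t in `[a, b]) Im (g t)).

Lemma eq_cint g1 g2 a b : (forall t, a <= t <= b -> g1 t = g2 t) ->
  cint g1 a b = cint g2 a b.
Proof.
by move=> E; rewrite /cint; congr (_ +i* _); apply: eq_Rintegral => t;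
  rewrite inE /= in_itv /= => /E ->.
Qed.

Lemma cint_split g a b c : a <= c <= b -> ccont g a b ->
  cint g a b = cint g a c + cint g c b.
Proof.
move=> acb cg; rewrite /cint.
rewrite (Rintegral_split acb (ccont_Re cg)) (Rintegral_split acb (ccont_Im cg)).
by [].
Qed.

(** The factor 2 is the price of bounding real and imaginary parts separately; it only enlarges
    constants. *)
Lemma cint_bound g a b M : a <= b -> ccont g a b ->
  (forall t, a <= t <= b -> normc (g t) <= M) ->
  normc (cint g a b) <= M * (b - a) *+ 2.
Proof.
move=> ab cg gM; apply: le_trans (normc_le_ReIm _) _; rewrite mulr2n lerD //=.
  apply: (Rintegral_bound ab (ccont_Re cg)) => t /gM; apply: le_trans.
  exact: normc_Re.
apply: (Rintegral_bound ab (ccont_Im cg)) => t /gM; apply: le_trans.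
exact: normc_Im.
Qed.

Lemma cintD g1 g2 a b : ccont g1 a b -> ccont g2 a b ->
  cint (fun t => g1 t + g2 t) a b = cint g1 a b + cint g2 a b.
Proof.
move=> c1 c2; rewrite /cint.
have -> : (fun t => Re (g1 t + g2 t)) = (fun t => Re (g1 t) + Re (g2 t)).
  by apply/funext => t; case: (g1 t); case: (g2 t).
have -> : (fun t => Im (g1 t + g2 t)) = (fun t => Im (g1 t) + Im (g2 t)).
  by apply/funext => t; case: (g1 t); case: (g2 t).
congr (_ +i* _).
  by apply: RintegralD => //; apply: rcont_integrable; exact: ccont_Re.
by apply: RintegralD => //; apply: rcont_integrable; exact: ccont_Im.
Qed.

Lemma cintZ (k : R[i]) g a b : ccont g a b ->
  cint (fun t => k * g t) a b = k * cint g a b.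
Proof.
move=> cg; case: k => p q; rewrite /cint.
have iR := rcont_integrable (ccont_Re cg).
have iI := rcont_integrable (ccont_Im cg).
have iZ (r : R) (h : R -> R) : rcont h a b ->
   mu.-integrable `[a, b] (EFin \o (fun t => r * h t)).
  move=> ch; apply: rcont_integrable => t tab; apply: cvgM; last exact: ch.
  exact: cvg_cst.
have [cR cI] := (ccont_Re cg, ccont_Im cg).
have -> : (fun t => Re ((p +i* q) * g t)) = (fun t => p * Re (g t) - q * Im (g t)).
  by apply/funext => t; case: (g t).
have -> : (fun t => Im ((p +i* q) * g t)) = (fun t => p * Im (g t) + q * Re (g t)).
  by apply/funext => t; case: (g t).
have E1 : \int[mu]_(t in `[a, b]) (p * Re (g t) - q * Im (g t)) =
    p * \int[mu]_(t in `[a, b]) Re (g t) - q * \int[mu]_(t in `[a, b]) Im (g t).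
  by rewrite -!RintegralZl //; apply: RintegralB => //; apply: iZ.
have E2 : \int[mu]_(t in `[a, b]) (p * Im (g t) + q * Re (g t)) =
    p * \int[mu]_(t in `[a, b]) Im (g t) + q * \int[mu]_(t in `[a, b]) Re (g t).
  by rewrite -!RintegralZl //; apply: RintegralD => //; apply: iZ.
by rewrite E1 E2.
Qed.

Lemma cint_FTC (P g : R -> R[i]) a b : a < b -> ccont g a b ->
  (forall t, a <= t <= b -> forall e : R, 0 < e -> exists2 d : R, 0 < d &
    forall h : R, `|h| < d -> normc (P (h + t) - P t - h%:C * g t) <= e * `|h|) ->
  cint g a b = P b - P a.
Proof.
move=> ab cg dP; rewrite /cint.
have ERe : \int[mu]_(t in `[a, b]) Re (g t) = Re (P b) - Re (P a).
  apply: (@Rintegral_FTC R (fun t => Re (g t)) (fun t => Re (P t)) _ _ ab (ccont_Re cg)).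
  move=> t /dP H; apply: is_derive_eps => e /H[d d0 Hd]; exists d => // h /Hd.
  apply: le_trans.
  rewrite (_ : _ - _ = Re (P (h + t) - P t - h%:C * g t)) ?normc_Re //=.
  by case: (P (h + t)) => ? ?; case: (P t) => ? ?; case: (g t) => ? ? /=; ring.
have EIm : \int[mu]_(t in `[a, b]) Im (g t) = Im (P b) - Im (P a).
  apply: (@Rintegral_FTC R (fun t => Im (g t)) (fun t => Im (P t)) _ _ ab (ccont_Im cg)).
  move=> t /dP H; apply: is_derive_eps => e /H[d d0 Hd]; exists d => // h /Hd.
  apply: le_trans.
  rewrite (_ : _ - _ = Im (P (h + t) - P t - h%:C * g t)) ?normc_Im //=.
  by case: (P (h + t)) => ? ?; case: (P t) => ? ?; case: (g t) => ? ? /=; ring.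
by rewrite ERe EIm; case: (P b); case: (P a).
Qed.

End ComplexIntegral.

(** * Goursat's lemma and Cauchy's formula *)

Section Boundary.
Variable R : realType.
Implicit Types (phi psi : R[i] -> R[i]) (a b c d x y : R) (z w l : R[i]).

Definition cts phi z := forall e : R, 0 < e -> exists2 r : R, 0 < r &
  forall w, normc (w - z) < r -> normc (phi w - phi z) < e.

Definition cdiff phi z l := forall e : R, 0 < e -> exists2 r : R, 0 < r &
  forall w, normc (w - z) < r ->
    normc (phi w - phi z - l * (w - z)) <= e * normc (w - z).

Lemma cdiff_cts phi z l : cdiff phi z l -> cts phi z.
Proof.
move=> H e e0; have [r r0 Hr] := H _ ltr01.
have k0 : 0 < 1 + normc l by rewrite ltr_wpDr ?normc_ge0.
exists (Num.min r (e / (1 + normc l))); first by rewrite lt_min r0 divr_gt0.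
move=> w; rewrite lt_min => /andP[/Hr wr we].
rewrite -[phi w - phi z](subrK (l * (w - z))).
apply: le_lt_trans (le_normcD _ _) _; rewrite normcM.
move: we; rewrite ltr_pdivlMr //; apply: le_lt_trans.
by rewrite [leRHS]mulrDr mulr1 lerD ?(mulrC (normc l)) //; move: wr; rewrite mul1r.
Qed.

Lemma ctsD phi psi z : cts phi z -> cts psi z -> cts (fun w => phi w + psi w) z.
Proof.
move=> H1 H2 e e0; have e20 : 0 < e / 2 by rewrite divr_gt0.
have [r r0 Hr] := H1 _ e20; have [s s0 Hs] := H2 _ e20.
exists (Num.min r s); first by rewrite lt_min r0.
move=> w; rewrite lt_min => /andP[/Hr wr /Hs ws].
rewrite opprD addrACA; apply: le_lt_trans (le_normcD _ _) _; lra.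
Qed.

Lemma ctsZ k phi z : cts phi z -> cts (fun w => k * phi w) z.
Proof.
move=> H e e0; have k0 : 0 < 1 + normc k by rewrite ltr_wpDr ?normc_ge0.
have [r r0 Hr] := H (e / (1 + normc k)) ltac:(by rewrite divr_gt0).
exists r => // w /Hr; rewrite -mulrBr normcM ltr_pdivlMr // => h.
apply: le_lt_trans h; rewrite mulrC ler_wpM2l ?normc_ge0 // lerDr //.
Qed.

Definition bnd a b c d z : Prop :=
  (a <= Re z <= b /\ (Im z = c \/ Im z = d)) \/
  (c <= Im z <= d /\ (Re z = a \/ Re z = b)).

(* Counterclockwise integral over the boundary of [a, b] x [c, d]. *)
Definition bint phi a b c d : R[i] :=
  cint (fun x => phi (x +i* c)) a b + 'i * cint (fun y => phi (b +i* y)) c d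
  - cint (fun x => phi (x +i* d)) a b - 'i * cint (fun y => phi (a +i* y)) c d.

Lemma ccontH phi a b y : (forall x, a <= x <= b -> cts phi (x +i* y)) ->
  ccont (fun x => phi (x +i* y)) a b.
Proof.
move=> H t /H{}H e /H[r r0 Hr]; exists r => // s st; apply: Hr.
rewrite (_ : _ - _ = (s - t)%:C) ?normc_real //.
by apply/eqP; rewrite eq_complex /= subrr !eqxx.
Qed.

Lemma ccontV phi c d x : (forall y, c <= y <= d -> cts phi (x +i* y)) ->
  ccont (fun y => phi (x +i* y)) c d.
Proof.
move=> H t /H{}H e /H[r r0 Hr]; exists r => // s st; apply: Hr.
rewrite (_ : _ - _ = 'i * (s - t)%:C) ?normcM ?normc_i ?mul1r ?normc_real //.
by apply/eqP; rewrite eq_complex /=; apply/andP; split; apply/eqP; ring.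
Qed.

Definition bcts phi a b c d := forall z, bnd a b c d z -> cts phi z.

Lemma bcts_sides phi a b c d : bcts phi a b c d ->
  [/\ ccont (fun x => phi (x +i* c)) a b, ccont (fun y => phi (b +i* y)) c d,
      ccont (fun x => phi (x +i* d)) a b & ccont (fun y => phi (a +i* y)) c d].
Proof.
move=> H; split; first [apply: ccontH | apply: ccontV]; move=> t tab;
  apply: H; rewrite /bnd /=; by [left; split; auto | right; split; auto].
Qed.

Lemma eq_bint phi psi a b c d : a <= b -> c <= d ->
  (forall z, bnd a b c d z -> phi z = psi z) -> bint phi a b c d = bint psi a b c d.
Proof.
move=> ab cd H; rewrite /bint; congr (_ + _ * _ - _ - _ * _);
  apply: eq_cint => t tab; apply: H; rewrite /bnd /=;
  by [left; split; auto | right; split; auto].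
Qed.

Lemma bintD phi psi a b c d : bcts phi a b c d -> bcts psi a b c d ->
  bint (fun z => phi z + psi z) a b c d = bint phi a b c d + bint psi a b c d.
Proof.
move=> /bcts_sides[? ? ? ?] /bcts_sides[? ? ? ?].
by rewrite /bint !cintD //; ring.
Qed.

Lemma bintZ k phi a b c d : bcts phi a b c d ->
  bint (fun z => k * phi z) a b c d = k * bint phi a b c d.
Proof. by move=> /bcts_sides[? ? ? ?]; rewrite /bint !cintZ //; ring. Qed.

Lemma bint_splitV phi a b c d m : a <= m <= b -> bcts phi a b c d ->
  bint phi a b c d = bint phi a m c d + bint phi m b c d.
Proof.
move=> amb /bcts_sides[? ? ? ?].
by rewrite /bint (cint_split amb) // (cint_split (g := fun x => phi (x +i* d)) amb) //; ring.
Qed.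

Lemma bint_splitH phi a b c d m : c <= m <= d -> bcts phi a b c d ->
  bint phi a b c d = bint phi a b c m + bint phi a b m d.
Proof.
move=> cmd /bcts_sides[? ? ? ?].
by rewrite /bint (cint_split cmd) // (cint_split (g := fun y => phi (a +i* y)) cmd) //; ring.
Qed.

Lemma bint_bound phi a b c d M : a <= b -> c <= d -> bcts phi a b c d ->
  (forall z, bnd a b c d z -> normc (phi z) <= M) ->
  normc (bint phi a b c d) <= M * ((b - a) + (d - c)) *+ 4.
Proof.
move=> ab cd H HM; have [h1 h2 h3 h4] := bcts_sides H.
have B1 := cint_bound (M := M) ab h1; have B2 := cint_bound (M := M) cd h2.
have B3 := cint_bound (M := M) ab h3; have B4 := cint_bound (M := M) cd h4.
rewrite /bint.
have tri (x y z w : R[i]) :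
    normc (x + y - z - w) <= normc x + normc y + normc z + normc w.
  apply: le_trans (le_normcD _ _) _; rewrite normcN lerD2r.
  apply: le_trans (le_normcD _ _) _; rewrite normcN lerD2r.
  exact: le_normcD.
apply: le_trans (tri _ _ _ _) _; rewrite !normcM !normc_i !mul1r.
have {}B1 := B1 ltac:(move=> t tab; apply: HM; left; split; auto).
have {}B2 := B2 ltac:(move=> t tab; apply: HM; right; split; auto).
have {}B3 := B3 ltac:(move=> t tab; apply: HM; left; split; auto).
have {}B4 := B4 ltac:(move=> t tab; apply: HM; right; split; auto).
apply: le_trans (lerD (lerD (lerD B1 B2) B3) B4) _.
by rewrite !mulr2n -[_ *+ 4]mulr_natr; lra.
Qed.

Lemma cdiff_lineH (G g : R[i] -> R[i]) t y : cdiff G (t +i* y) (g (t +i* y)) ->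
  forall e : R, 0 < e -> exists2 r : R, 0 < r & forall h : R, `|h| < r ->
    normc (G ((h + t) +i* y) - G (t +i* y) - h%:C * g (t +i* y)) <= e * `|h|.
Proof.
move=> H e /H[r r0 Hr]; exists r => // h hr.
have E : ((h + t) +i* y) - (t +i* y) = h%:C.
  by apply/eqP; rewrite eq_complex /= subrr addrK !eqxx.
by have := Hr ((h + t) +i* y); rewrite E normc_real [g _ * _]mulrC => /(_ hr).
Qed.

Lemma cdiff_lineV (G g : R[i] -> R[i]) x t : cdiff G (x +i* t) (g (x +i* t)) ->
  forall e : R, 0 < e -> exists2 r : R, 0 < r & forall h : R, `|h| < r ->
    normc (G (x +i* (h + t)) - G (x +i* t) - h%:C * ('i * g (x +i* t))) <= e * `|h|.
Proof.
move=> H e /H[r r0 Hr]; exists r => // h hr.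
have E : (x +i* (h + t)) - (x +i* t) = 'i * h%:C.
  by apply/eqP; rewrite eq_complex /=; apply/andP; split; apply/eqP; ring.
have := Hr (x +i* (h + t)); rewrite E.
rewrite (_ : g _ * _ = h%:C * ('i * g (x +i* t))); last by ring.
by rewrite normcM normc_i mul1r normc_real => /(_ hr).
Qed.

(** The corner values of the primitive cancel around the contour. The primitive lives only along the
    boundary, so that negative powers of w, singular inside the square, are covered. *)
Lemma bint_primitive (G g : R[i] -> R[i]) a b c d : a < b -> c < d ->
  bcts g a b c d -> (forall z, bnd a b c d z -> cdiff G z (g z)) ->
  bint g a b c d = 0.
Proof.
move=> ab cd cg dG; have [h1 h2 h3 h4] := bcts_sides cg.
have ci (x : R) : ccont (fun y => g (x +i* y)) c d ->
    ccont (fun y => 'i * g (x +i* y)) c d.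
  move=> H t /H{}H e /H[r r0 Hr]; exists r => // s /Hr.
  by rewrite -mulrBr normcM normc_i mul1r.
rewrite /bint -!cintZ //.
have E1 : cint (fun x => g (x +i* c)) a b = G (b +i* c) - G (a +i* c).
  apply: (@cint_FTC R (fun x => G (x +i* c))) => // t tab.
  by apply: cdiff_lineH; apply: dG; left; split; auto.
have E2 : cint (fun x => g (x +i* d)) a b = G (b +i* d) - G (a +i* d).
  apply: (@cint_FTC R (fun x => G (x +i* d))) => // t tab.
  by apply: cdiff_lineH; apply: dG; left; split; auto.
have E3 : cint (fun y => 'i * g (a +i* y)) c d = G (a +i* d) - G (a +i* c).
  apply: (@cint_FTC R (fun y => G (a +i* y))) => //; first exact: ci.
  by move=> t tab; apply: cdiff_lineV; apply: dG; right; split; auto.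
have E4 : cint (fun y => 'i * g (b +i* y)) c d = G (b +i* d) - G (b +i* c).
  apply: (@cint_FTC R (fun y => G (b +i* y))) => //; first exact: ci.
  by move=> t tab; apply: cdiff_lineV; apply: dG; right; split; auto.
by rewrite E1 E2 E3 E4; ring.
Qed.

Lemma cdiff_quadratic k l z0 z :
  cdiff (fun w => k * w + l / 2 * (w - z0) ^+ 2) z (k + l * (z - z0)).
Proof.
move=> e e0; have l0 : 0 < 1 + normc (l / 2) by rewrite ltr_wpDr ?normc_ge0.
exists (e / (1 + normc (l / 2))); first by rewrite divr_gt0.
move=> w; rewrite ltr_pdivlMr // => wz.
rewrite (_ : _ - _ = l / 2 * (w - z) * (w - z)); last by field.
rewrite !normcM ler_wpM2r ?normc_ge0 //.
rewrite -normcM mulrC; apply: le_trans (ltW wz).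
by rewrite normcM ler_wpM2l ?normc_ge0 // lerDr.
Qed.

Lemma cdiff_linear k l z0 z : cdiff (fun w => k + l * (w - z0)) z l.
Proof.
move=> e e0; exists 1 => // w _.
rewrite (_ : _ - _ = 0); last by ring.
by rewrite normc0 mulr_ge0 ?normc_ge0 // ltW.
Qed.

Lemma bint_affine k l z0 a b c d : a < b -> c < d ->
  bint (fun z => k + l * (z - z0)) a b c d = 0.
Proof.
move=> ab cd; apply: bint_primitive => // z _; last exact: cdiff_quadratic.
exact: cdiff_cts (cdiff_linear _ _ _ _).
Qed.

End Boundary.

(** * Nested subdivision of rectangles *)

Section Bisection.
Variable R : realType.

(** The supremum of the left endpoints is a common point, since every right endpoint bounds all of
    them. *)
Lemma nested_point (x l : nat -> R) : (forall k, 0 <= l k) ->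
  (forall k, x k <= x k.+1 /\ x k.+1 + l k.+1 <= x k + l k) ->
  exists u, forall k, x k <= u <= x k + l k.
Proof.
move=> l0 H.
have up j k : x j <= x (j + k)%N /\ x (j + k)%N + l (j + k)%N <= x j + l j.
  elim: k => [|k [IH1 IH2]]; first by rewrite addn0.
  have [] := H (j + k)%N; rewrite addnS => h1 h2; split.
    exact: le_trans h1.
  exact: le_trans IH2.
have ub j k : x j <= x k + l k.
  have [jk|kj] := leqP j k.
    have [+ _] := up j (k - j)%N; rewrite subnKC // => h.
    by apply: le_trans h _; rewrite lerDl.
  have [_ +] := up k (j - k)%N; rewrite subnKC 1?ltnW // => h.
  by apply: le_trans h; rewrite lerDl.
have hs : has_sup (range x).
  split; first by exists (x 0%N); exists 0%N.
  by exists (x 0%N + l 0%N) => _ [j _ <-].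
exists (sup (range x)) => k; apply/andP; split.
  by apply: (ub_le_sup hs.2); exists k.
by apply: ge_sup; [exact: hs.1|move=> _ [j _ <-]].
Qed.

Lemma halving_small (e : R) : 0 < e -> exists k, (2^-1 ^+ k < e).
Proof.
move=> e0; have [k _ Hk] := near_infty_natSinv_expn_lt (PosNum e0).
by exists k; have := Hk k (leqnn k); rewrite /= div1r exprVn.
Qed.

(** [P x y s] speaks of the rectangle with lower left corner (x, y) and sides [s * w] and [s * h].
    If it failed at scale 1, some quarter would fail at each stage; the failing rectangles shrink to
    a point (u, v), where the local hypothesis is contradicted. *)
Lemma bisection (w h x0 y0 : R) (P : R -> R -> R -> Prop) : 0 < w -> 0 < h ->
  (forall x y s, 0 < s -> P x y (s / 2) -> P (x + s / 2 * w) y (s / 2) ->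
     P x (y + s / 2 * h) (s / 2) -> P (x + s / 2 * w) (y + s / 2 * h) (s / 2) ->
     P x y s) ->
  (forall u v, exists2 r : R, 0 < r & forall x y s, 0 < s < r ->
     x <= u <= x + s * w -> y <= v <= y + s * h -> P x y s) ->
  P x0 y0 1.
Proof.
move=> w0 h0 Hdiv Hloc; apply: contrapT => nP.
(* A failing quarter is chosen for all triples at once; the function is total, with a dummy value
   where the triple is not a failing one. *)
have [step Hstep] : {step : R * R * R -> R * R * R & forall t,
    0 < t.2 -> ~ P t.1.1 t.1.2 t.2 ->
    [/\ ~ P (step t).1.1 (step t).1.2 (step t).2, (step t).2 = t.2 / 2,
      (step t).1.1 = t.1.1 \/ (step t).1.1 = t.1.1 + t.2 / 2 * w &
      (step t).1.2 = t.1.2 \/ (step t).1.2 = t.1.2 + t.2 / 2 * h]}.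
  apply: (@choice _ _ (fun t t' => 0 < t.2 -> ~ P t.1.1 t.1.2 t.2 ->
    [/\ ~ P t'.1.1 t'.1.2 t'.2, t'.2 = t.2 / 2,
      t'.1.1 = t.1.1 \/ t'.1.1 = t.1.1 + t.2 / 2 * w &
      t'.1.2 = t.1.2 \/ t'.1.2 = t.1.2 + t.2 / 2 * h])).
  move=> [[x y] s] /=.
  have [s0|] := boolP (0 < s); last by move=> _; exists (x, y, s).
  have [?|nPs] := pselect (P x y s); first by exists (x, y, s).
  have [h1|h1] := pselect (P x y (s / 2)); last first.
    by exists (x, y, s / 2) => _ _ /=; split; auto.
  have [h2|h2] := pselect (P (x + s / 2 * w) y (s / 2)); last first.
    by exists (x + s / 2 * w, y, s / 2) => _ _ /=; split; auto.
  have [h3|h3] := pselect (P x (y + s / 2 * h) (s / 2)); last first.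
    by exists (x, y + s / 2 * h, s / 2) => _ _ /=; split; auto.
  have [h4|h4] := pselect (P (x + s / 2 * w) (y + s / 2 * h) (s / 2)); last first.
    by exists (x + s / 2 * w, y + s / 2 * h, s / 2) => _ _ /=; split; auto.
  by exfalso; apply: nPs; exact: Hdiv.
pose t k := iter k step (x0, y0, 1).
have tP k : (t k).2 = 2^-1 ^+ k /\ ~ P (t k).1.1 (t k).1.2 (t k).2.
  elim: k => [|k [IH1 IH2]]; first by rewrite /t /= expr0.
  have pos : 0 < (t k).2 by rewrite IH1 exprn_gt0.
  have [h1 h2 _ _] := Hstep _ pos IH2.
  by split => //; rewrite [LHS]h2 IH1 exprS mulrC.
have pos k : 0 < (t k).2 by have [-> _] := tP k; rewrite exprn_gt0.
have tS k := Hstep _ (pos k) (tP k).2.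
have [u Hu] : exists u, forall k, (t k).1.1 <= u <= (t k).1.1 + (t k).2 * w.
  apply: nested_point => k; first by rewrite mulr_ge0 // ltW.
  have [_ h2 h3 _] := tS k; rewrite [(t k.+1).2]h2.
  have := mulr_gt0 (pos k) w0.
  by case: h3 => h3; rewrite /t iterS in h3 *; rewrite h3; rewrite -/(t k); lra.
have [v Hv] : exists v, forall k, (t k).1.2 <= v <= (t k).1.2 + (t k).2 * h.
  apply: nested_point => k; first by rewrite mulr_ge0 // ltW.
  have [_ h2 _ h3] := tS k; rewrite [(t k.+1).2]h2.
  have := mulr_gt0 (pos k) h0.
  by case: h3 => h3; rewrite /t iterS in h3 *; rewrite h3; rewrite -/(t k); lra.
have [r r0 Hr] := Hloc u v.
have [k kr] := halving_small r0.
apply: (tP k).2; apply: Hr => //; rewrite (pos k) /=.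
by rewrite (tP k).1.
Qed.

End Bisection.

Section Goursat.
Variable R : realType.
Implicit Types (phi psi g : R[i] -> R[i]) (a b c d : R) (z w l : R[i]).

Lemma bnd_box a b c d z : a <= b -> c <= d -> bnd a b c d z ->
  a <= Re z <= b /\ c <= Im z <= d.
Proof.
by move=> ab cd [[-> [] ->]|[-> [] ->]]; rewrite !lexx ?ab ?cd.
Qed.

Lemma halving_bounds (a b w x s : R) : 0 < w -> 0 < s -> a <= x -> x + s * w <= b ->
  [/\ a <= x + s / 2 * w, x + s / 2 * w <= b, x <= x + s / 2 * w,
      x + s / 2 * w <= x + s * w &
      x + s / 2 * w + s / 2 * w = x + s * w].
Proof.
move=> w0 s0 ax xb; have sw := mulr_gt0 s0 w0.
have -> : s / 2 * w = s * w / 2 by field.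
by split; lra.
Qed.

Lemma goursat phi a b c d : a < b -> c < d ->
  (forall z, a <= Re z <= b -> c <= Im z <= d -> exists l, cdiff phi z l) ->
  bint phi a b c d = 0.
Proof.
move=> ab cd dphi; apply/eqP; rewrite -normc_eq0 eq_le normc_ge0 andbT.
apply/ler_addgt0Pl => e e0; rewrite addr0.
have [w Ew] : {w : R | w = b - a} by exists (b - a).
have [h Eh] : {h : R | h = d - c} by exists (d - c).
have [L EL] : {L : R | L = w + h} by exists (w + h).
have w0 : 0 < w by rewrite Ew subr_gt0.
have h0 : 0 < h by rewrite Eh subr_gt0.
have L0 : 0 < L by rewrite EL addr_gt0.
(* Normalised so that the bound in [P] at scale 1 is exactly [e]. *)
pose ep := e / (4 * L ^+ 2).
have ep0 : 0 < ep by rewrite divr_gt0 // mulr_gt0 // exprn_gt0.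
have cphi x X y Y : a <= x -> x <= X -> X <= b -> c <= y -> y <= Y -> Y <= d ->
    bcts phi x X y Y.
  move=> ax xX Xb cy yY Yd z /(bnd_box xX yY)[/andP[z1 z2] /andP[z3 z4]].
  have [|| l] := dphi z; first by rewrite (le_trans ax) // (le_trans z2).
    by rewrite (le_trans cy) // (le_trans z4).
  exact: cdiff_cts.
(* The bound is proportional to [s ^+ 2], so the bounds for the four quarters add up exactly to the
   bound for the whole. *)
pose P x y s := a <= x -> x + s * w <= b -> c <= y -> y + s * h <= d ->
  normc (bint phi x (x + s * w) y (y + s * h)) <= ep * s ^+ 2 * L ^+ 2 * 4.
suff : P a c 1.
  rewrite /P !mul1r Ew Eh !subrKC !lexx => /(_ isT isT isT isT).
  by rewrite expr1n mulr1 /ep -mulrA (mulrC (L ^+ 2)) divfK // mulf_neq0 ?expf_neq0 ?gt_eqF.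
apply: (@bisection R w h) => //.
  move=> x y s s0 P1 P2 P3 P4 ax xb cy yd.
  have [am mb xm mX Em] := halving_bounds w0 s0 ax xb.
  have [cn nd yn nY En] := halving_bounds h0 s0 cy yd.
  have [xX yY] := (le_trans xm mX, le_trans yn nY).
  rewrite /P Em En in P1 P2 P3 P4.
  have {}P1 := P1 ax mb cy nd.
  have {}P2 := P2 am xb cy nd.
  have {}P3 := P3 ax mb cn yd.
  have {}P4 := P4 am xb cn yd.
  rewrite (@bint_splitV _ _ _ _ _ _ (x + s / 2 * w)); [|by rewrite xm|exact: cphi].
  rewrite (@bint_splitH _ _ x (x + s / 2 * w) _ _ (y + s / 2 * h)); [|by rewrite yn|exact: cphi].
  rewrite (@bint_splitH _ _ (x + s / 2 * w) _ _ _ (y + s / 2 * h)); [|by rewrite yn|exact: cphi].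
  apply: le_trans (le_normcD _ _) _.
  apply: le_trans (lerD (le_normcD _ _) (le_normcD _ _)) _.
  apply: le_trans (lerD (lerD P1 P3) (lerD P2 P4)) _.
  rewrite le_eqVlt; apply/orP; left; apply/eqP; by field.
move=> u v.
have [[ub vb]|nuv] := pselect (a <= u <= b /\ c <= v <= d); last first.
  (* A point outside the large rectangle lies in none of its subrectangles, so any radius will
     do. *)
  exists 1 => // x y s _ /andP[xu uX] /andP[yv vY] ax Xb cy Yd; exfalso; apply: nuv.
  by split; apply/andP; split; lra.
have [l /(_ _ ep0)[r r0 Hr]] := dphi (u +i* v) ub vb.
exists (r / L); first by rewrite divr_gt0.
move=> x y s /andP[s0]; rewrite ltr_pdivlMr // => sr /andP[xu uX] /andP[yv vY] ax Xb cy Yd.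
have sw := mulr_gt0 s0 w0; have sh := mulr_gt0 s0 h0.
have [xX yY] : x <= x + s * w /\ y <= y + s * h by rewrite !lerDl !ltW.
pose z0 := u +i* v.
(* The affine part of [phi] at [z0] integrates to 0. The rest is at most [ep * (s * L)] on the
   boundary, and the side lengths contribute a second factor [s * L]. *)
pose A := fun z => phi z0 + l * (z - z0).
have cA : bcts A x (x + s * w) y (y + s * h).
  by move=> z _; exact: cdiff_cts (cdiff_linear _ _ _ _).
have cph : bcts phi x (x + s * w) y (y + s * h) by exact: cphi.
have cNA : bcts (fun z => (-1) * A z) x (x + s * w) y (y + s * h).
  by move=> z /cA ?; exact: ctsZ.
have cD : bcts (fun z => phi z + (-1) * A z) x (x + s * w) y (y + s * h).
  by move=> z zb; apply: ctsD; [exact: cph|exact: cNA].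
have -> : bint phi x (x + s * w) y (y + s * h) =
    bint (fun z => phi z + (-1) * A z) x (x + s * w) y (y + s * h).
  by rewrite bintD // bintZ // bint_affine ?mulr0 ?addr0 // ltrDl.
have -> : ep * s ^+ 2 * L ^+ 2 * 4 =
    ep * (s * L) * ((x + s * w - x) + (y + s * h - y)) *+ 4.
  by rewrite -[RHS]mulr_natr EL; ring.
apply: bint_bound => // z /(bnd_box xX yY)[/andP[z1 z2] /andP[z3 z4]].
have zs : normc (z - z0) <= s * L.
  apply: le_trans (normc_le_ReIm _) _; rewrite EL mulrDr; apply: lerD.
    rewrite (_ : Re _ = Re z - u); last by case: (z).
    rewrite ler_norml; apply/andP; split; clear - z1 z2 xu uX; lra.
  rewrite (_ : Im _ = Im z - v); last by case: (z).
  rewrite ler_norml; apply/andP; split; clear - z3 z4 yv vY; lra.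
rewrite (_ : _ + _ = phi z - phi z0 - l * (z - z0)); last by rewrite /A; ring.
apply: le_trans (Hr _ _) _; first exact: le_lt_trans zs sr.
by rewrite ler_wpM2l // ltW.
Qed.

(* Used with a difference quotient of phi, about whose value at p +i* q nothing is known. *)
Lemma goursat_hole phi a b c d p q e : 0 < e ->
  a < p - e -> p + e < b -> c < q - e -> q + e < d ->
  (forall z, a <= Re z <= b -> c <= Im z <= d -> z != p +i* q ->
     exists l, cdiff phi z l) ->
  bint phi a b c d = bint phi (p - e) (p + e) (q - e) (q + e).
Proof.
move=> e0 ap pb cq qd dphi.
have neq (z : R[i]) : Re z != p \/ Im z != q -> z != p +i* q.
  by case: z => x y /= H; rewrite eq_complex /= negb_and; apply/orP.
have cphi x X y Y : a <= x -> x <= X -> X <= b -> c <= y -> y <= Y -> Y <= d ->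
    [/\ x != p, X != p, y != q & Y != q] -> bcts phi x X y Y.
  move=> ax xX Xb cy yY Yd [n1 n2 n3 n4] z zb.
  have [/andP[z1 z2] /andP[z3 z4]] := bnd_box xX yY zb.
  have [||| l] := dphi z; last exact: cdiff_cts.
  - by rewrite (le_trans ax) // (le_trans z2).
  - by rewrite (le_trans cy) // (le_trans z4).
  - by apply: neq; case: zb => [[_ [] ->]|[_ [] ->]]; auto.
have [[P1 P2 P3] [P4 P5 P6] [P7 P8]] : [/\ [/\ a <= p - e, p - e <= p + e & p + e <= b],
    [/\ a <= p + e, p - e <= b & a <= b] & p - e < p /\ p < p + e].
  by clear - e0 ap pb; split; split; lra.
have [[Q1 Q2 Q3] [Q4 Q5 Q6] [Q7 Q8]] : [/\ [/\ c <= q - e, q - e <= q + e & q + e <= d],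
    [/\ c <= q + e, q - e <= d & c <= d] & q - e < q /\ q < q + e].
  by clear - e0 cq qd; split; split; lra.
have [ap' pb'] := (le_lt_trans P1 P7, lt_le_trans P8 P3).
have [cq' qd'] := (le_lt_trans Q1 Q7, lt_le_trans Q8 Q3).
have [[ne1 ne2] [na nb]] : (p - e != p /\ p + e != p) /\ (a != p /\ b != p).
  by split; split; rewrite ?(lt_eqF P7) ?(gt_eqF P8) ?(lt_eqF ap') ?(gt_eqF pb').
have [[ne3 ne4] [nc nd]] : (q - e != q /\ q + e != q) /\ (c != q /\ d != q).
  by split; split; rewrite ?(lt_eqF Q7) ?(gt_eqF Q8) ?(lt_eqF cq') ?(gt_eqF qd').
(* A closed subrectangle lying strictly to one side of the exceptional point falls under Goursat's
   lemma. *)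
have zero x X y Y : a <= x -> x < X -> X <= b -> c <= y -> y < Y -> Y <= d ->
    X < p \/ p < x \/ Y < q \/ q < y -> bint phi x X y Y = 0.
  move=> ax xX Xb cy yY Yd out; apply: goursat => // z /andP[z1 z2] /andP[z3 z4].
  apply: dphi; [by rewrite (le_trans ax) ?(le_trans z2)|by rewrite (le_trans cy) ?(le_trans z4)|].
  apply: neq; case: out => [lt1|[lt1|[lt1|lt1]]]; [left|left|right|right].
  - by rewrite lt_eqF // (le_lt_trans z2).
  - by rewrite gt_eqF // (lt_le_trans lt1).
  - by rewrite lt_eqF // (le_lt_trans z4).
  - by rewrite gt_eqF // (lt_le_trans lt1).
have [pe qe] : p - e < p + e /\ q - e < q + e 
  by split; [exact: lt_trans P7 P8|exact: lt_trans Q7 Q8].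
have [cd ab] : c < d /\ a < b.
  by split; [exact: lt_trans cq' qd'|exact: lt_trans ap' pb'].
(* The large rectangle without the small square: a left and a right strip of full height, and the
   pieces below and above the square. *)
have Z1 : bint phi a (p - e) c d = 0 by apply: zero => //; auto.
have Z2 : bint phi (p + e) b c d = 0 by apply: zero => //; auto.
have Z3 : bint phi (p - e) (p + e) c (q - e) = 0 by apply: zero => //; auto.
have Z4 : bint phi (p - e) (p + e) (q + e) d = 0 by apply: zero => //; auto.
rewrite (@bint_splitV _ _ _ _ _ _ (p - e)); [|by apply/andP|by apply: cphi].
rewrite (@bint_splitV _ _ (p - e) _ _ _ (p + e)); [|by apply/andP|by apply: cphi].
rewrite (@bint_splitH _ _ (p - e) _ _ _ (q - e)); [|by apply/andP|by apply: cphi].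
rewrite (@bint_splitH _ _ (p - e) _ (q - e) _ (q + e)); [|by apply/andP|by apply: cphi].
rewrite Z1 Z2 Z3 Z4.
by rewrite !add0r !addr0.
Qed.

Lemma cdiffP phi z l :
  cdiff phi z l <-> is_derive (z : R[i]^o) 1 (phi : R[i]^o -> R[i]^o) (l : R[i]^o).
Proof.
split=> H.
  apply/is_derive_realP => e /H[r r0 Hr]; exists r => // h hr.
  have := Hr (h + z); rewrite addrK [l * _]mulrC /GRing.scale /= mulr1; exact.
move/is_derive_realP: H => H e /H[r r0 Hr]; exists r => // w wr.
have := Hr (w - z) wr; rewrite [_ * l]mulrC.
by rewrite [_ *: _](_ : _ = w - z) ?subrK // /GRing.scale /= mulr1.
Qed.

Lemma cdiffableP phi z :
  (exists l, cdiff phi z l) <-> derivable (phi : R[i]^o -> R[i]^o) z 1.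
Proof.
split=> [[l /cdiffP[]] //|dz]; exists ('D_1 (phi : R[i]^o -> R[i]^o) z).
exact/cdiffP/derivableP.
Qed.

Lemma ctsP phi z : cts phi z <-> {for z, continuous (phi : R[i]^o -> R[i]^o)}.
Proof.
by split=> [H|/continuous_realP H]; [apply/continuous_realP => e /H[r r0 Hr]|move=> e /H[r r0 Hr]];
  exists r => // w; have := Hr w; rewrite -!ltcR; exact.
Qed.

End Goursat.

(** * Cauchy's formula and Taylor coefficients on the square *)

Section Cauchy.
Variable R : realType.
Implicit Types (phi psi g : R[i] -> R[i]) (z w l : R[i]).
Local Notation sq phi := (bint phi (-1) 1 (-1) 1).
Local Notation bsq := (bnd (-1) 1 (-1) 1 : R[i] -> Prop).

Lemma bsq_norm w : bsq w -> 1 <= normc w.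
Proof.
have nR := normc_Re w; have nI := normc_Im w.
move=> [[_ [] E]|[_ [] E]]; [apply: le_trans nI|apply: le_trans nI|
  apply: le_trans nR|apply: le_trans nR];
  by rewrite E ?normrN normr1.
Qed.

Lemma bsq_neq z w : bsq w -> normc z <= 1 / 2 -> normc (w - z)^-1 <= 2 /\ w - z != 0.
Proof.
move=> /bsq_norm w1 z1.
have h : normc w <= normc (w - z) + normc z.
  by rewrite -{1}(subrK z w) le_normcD.
have h2 : 1 / 2 <= normc (w - z) by lra.
have wz0 : 0 < normc (w - z) by lra.
split; last by rewrite -normc_gt0.
rewrite normcV -[2 : R]invrK lef_pV2 // ?posrE ?invr_gt0 // -div1r; lra.
Qed.

Lemma ctsM phi psi z : cts phi z -> cts psi z -> cts (fun w => phi w * psi w) z.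
Proof.
move=> /ctsP c1 /ctsP c2; apply/ctsP.
exact: (@continuousM R[i] R[i]^o (phi : R[i]^o -> R[i]^o) (psi : R[i]^o -> R[i]^o) z c1 c2).
Qed.

Lemma cts_cst k z : cts (fun=> k) z.
Proof. by move=> e e0; exists 1 => // w _; rewrite subrr normc0. Qed.

Lemma cts_sub z k : cts (fun w => w - k) z.
Proof. by move=> e e0; exists e => // w; rewrite opprB addrA subrK. Qed.

Lemma cts_inv z k : z - k != 0 -> cts (fun w => (w - k)^-1) z.
Proof.
move=> z0; apply/ctsP.
exact: (@continuousV R[i] R[i]^o (fun w : R[i]^o => (w - k : R[i]^o)) z z0
  ((ctsP _ _).1 (cts_sub z k))).
Qed.

Lemma cts_invX z j : z != 0 -> cts (fun w => w^-1 ^+ j) z.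
Proof.
move=> z0; have ci : cts (fun w => w^-1) z.
  have := @cts_inv z 0; rewrite subr0 => /(_ z0).
  by rewrite (_ : (fun _ => _) = fun w => w^-1) //; apply/funext => w; rewrite subr0.
elim: j => [|j IH].
  by rewrite (_ : (fun _ => _) = fun=> 1); [exact: cts_cst|apply/funext => w; rewrite expr0].
rewrite (_ : (fun _ => _) = fun w => w^-1 * w^-1 ^+ j).
  exact: ctsM.
by apply/funext => w; rewrite exprS.
Qed.

(** This integrates the finite geometric expansion of 1 / (w - z) in powers of z / w, with remainder
    z^k / (w^k (w - z)). The constant 32 is 2 for |1 / (w - z)|, times 4 for the sum of two sides,
    times 4 from [bint_bound]. *)
Lemma sq_expansion psi M z k : normc z <= 1 / 2 -> bcts psi (-1) 1 (-1) 1 ->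
  (forall w, bsq w -> normc (psi w) <= M) ->
  normc (sq (fun w => psi w * (w - z)^-1) -
         \sum_(j < k) z ^+ j * sq (fun w => psi w * w^-1 ^+ j.+1)) <=
  32 * M * normc z ^+ k.
Proof.
move=> z1 cpsi HM.
have N1 : (-1 : R) <= 1 by lra.
have w0 w : bsq w -> w != 0 by move=> /bsq_norm; rewrite -normc_gt0; apply: lt_le_trans.
have c1 j : bcts (fun w => psi w * w^-1 ^+ j) (-1) 1 (-1) 1.
  by move=> w bw; apply: ctsM; [exact: cpsi|exact/cts_invX/w0].
have c2 j : bcts (fun w => psi w * w^-1 ^+ j * (w - z)^-1) (-1) 1 (-1) 1.
  by move=> w bw; apply: ctsM; [exact: c1|apply: cts_inv; case: (bsq_neq bw z1)].
pose r j := sq (fun w => psi w * w^-1 ^+ j * (w - z)^-1).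
have rS j : r j = sq (fun w => psi w * w^-1 ^+ j.+1) + z * r j.+1.
  rewrite -bintZ // -bintD //; last by move=> w /c2 ?; exact: ctsZ.
  apply: eq_bint => // w bw; have := w0 _ bw; have [_] := bsq_neq bw z1.
  by move=> wz w00; rewrite exprS; field; rewrite wz w00.
have rE : r 0%N = \sum_(j < k) z ^+ j * sq (fun w => psi w * w^-1 ^+ j.+1) + z ^+ k * r k.
  elim: k => [|k IH]; first by rewrite big_ord0 add0r mul1r.
  by rewrite big_ord_recr /= {1}IH rS exprS; ring.
have -> : sq (fun w => psi w * (w - z)^-1) = r 0%N.
  by apply: eq_bint => // w _; rewrite expr0 mulr1.
rewrite rE addrAC subrr add0r normcM normcX mulrC ler_wpM2r ?exprn_ge0 ?normc_ge0 //.
have M0 : 0 <= M.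
  by apply: le_trans (normc_ge0 _) (HM ((-1) +i* (-1)) _); left; rewrite /= lexx; split; [lra|left].
have -> : 32 * M = M * 2 * ((1 - -1) + (1 - -1)) *+ 4.
  by rewrite -[RHS]mulr_natr; ring.
apply: bint_bound => // w bw.
rewrite !normcM ler_pM ?normc_ge0 ?mulr_ge0 ?normc_ge0 //; last first.
  by case: (bsq_neq bw z1).
rewrite -[leRHS]mulr1 ler_pM ?normc_ge0 ?HM // normcX exprn_ile1 ?normc_ge0 //.
by rewrite normcV invf_le1 ?bsq_norm // normc_gt0 w0.
Qed.

(** These powers have the single-valued primitive - w^(-j-1) / (j+1) along the boundary; 1 / w is
    the one negative power left over. *)
Lemma sq_invX j : sq (fun w => w^-1 ^+ j.+2) = 0.
Proof.
have w0 w : bsq w -> w != 0 by move=> /bsq_norm; rewrite -normc_gt0; apply: lt_le_trans.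
apply: (@bint_primitive _ (fun w => - (j.+1%:R)^-1 * w^-1 ^+ j.+1)); [lra|lra| |].
  by move=> w /w0; exact: cts_invX.
move=> w /w0 wn0; apply/cdiffP.
have d0 : is_derive (w : R[i]^o) 1 (fun w : R[i]^o => w^-1) (- w ^- 2 : R[i]^o).
  have di := @derivable_id _ R[i]^o w 1.
  split; first exact: (derivableV wn0 di).
  by rewrite (deriveV wn0 di) derive_id /GRing.scale /= mulr1.
have d1 := is_deriveX j.+1 d0; rewrite exprfctE in d1.
have d2 := is_deriveZ (- (j.+1%:R)^-1 : R[i]) d1.
have E : - (j.+1%:R)^-1 *: ((j.+1%:R * w^-1 ^+ j) *: - w ^- 2) = w^-1 ^+ j.+2 :> R[i]^o.
  rewrite /GRing.scale /= !exprVn !exprS.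
  have nj : j.+1%:R != 0 :> R[i] by rewrite pnatr_eq0.
  have wj : w ^+ j != 0 by rewrite expf_neq0.
  move: (j.+1%:R) (w ^+ j) nj wj => x y nj wj.
  by field; rewrite wn0 nj wj.
rewrite -E; exact: d2.
Qed.

(* By symmetry the four sides contribute the same imaginary part,
   the integral of 1 / (1 + t^2) over [-1, 1]. *)
Lemma sq_inv_neq0 : sq (fun w : R[i] => w^-1) != 0.
Proof.
have w0 w : bsq w -> w != 0 by move=> /bsq_norm; rewrite -normc_gt0; apply: lt_le_trans.
have c1 : bcts (fun w : R[i] => w^-1) (-1) 1 (-1) 1.
  by move=> w /w0 wn0; have := @cts_invX w 1 wn0.
have den t : 0 < 1 + t ^+ 2 :> R by rewrite ltr_wpDr ?sqr_ge0.
have [cH _ _ _] := bcts_sides c1.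
pose h (t : R) := Im (t +i* (-1))^-1.
have ch : rcont h (-1) 1 by exact: (ccont_Im cH).
have hE t : h t = (1 + t ^+ 2)^-1.
  by rewrite /h /= sqrrN expr1n mulN1r opprK addrC.
pose J := \int[@lebesgue_measure R]_(t in `[-1, 1]) h t.
(* On [-1, 1] the integrand is at least 1/2, and the interval has length 2. *)
have J1 : 1 <= J.
  have -> : 1 = \int[@lebesgue_measure R]_(t in `[-1, 1]) 2^-1 :> R.
    rewrite Rintegral_cst //= lebesgue_measure_itv /= lte_fin.
    by rewrite (_ : -1 < 1) /=; [field|lra].
  apply: le_Rintegral => //.
  - by apply: (rcont_integrable (h := cst _)) => t _; exact: cvg_cst.
  - exact: rcont_integrable.
  - move=> t; rewrite /= in_itv /= => /andP[t1 t2].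
    rewrite hE lef_pV2 ?posrE // -subr_ge0 (_ : _ - _ = (1 - t) * (1 + t)); last by ring.
    by rewrite mulr_ge0 //; lra.
suff : Im (sq (fun w : R[i] => w^-1)) = 4 * J.
  by apply: contra_eq_neq => ->; rewrite /=; lra.
have ImD (u v : R[i]) : Im (u + v) = Im u + Im v by case: u; case: v.
have ImB (u v : R[i]) : Im (u - v) = Im u - Im v by case: u; case: v.
have Imi (u : R[i]) : Im ('i * u) = Re u.
  by case: u => x y /=; rewrite mul0r mul1r add0r.
rewrite /bint !ImB ImD !Imi /=.
set I1 := (X in X + _ - _ - _); set I2 := (X in _ + X - _ - _).
set I3 := (X in _ + _ - X - _); set I4 := (X in _ - X = _).
have -> : I1 = J by apply: eq_Rintegral => t _; rewrite hE sqrrN expr1n mulN1r opprK addrC.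
have -> : I2 = J by apply: eq_Rintegral => t _; rewrite hE expr1n mul1r.
have -> : I3 = (-1) * J.
  rewrite -RintegralZl //; last exact: rcont_integrable.
  by apply: eq_Rintegral => t _; rewrite hE expr1n mul1r mulN1r addrC.
have -> : I4 = (-1) * J.
  rewrite -RintegralZl //; last exact: rcont_integrable.
  by apply: eq_Rintegral => t _; rewrite hE sqrrN expr1n.
by ring.
Qed.

(** In the expansion with [psi] equal to 1 every term beyond the first vanishes by [sq_invX], so the
    difference is at most 32 |z|^(m+1) for every m. *)
Lemma sq_inv_shift z : normc z <= 1 / 2 ->
  sq (fun w => (w - z)^-1) = sq (fun w => w^-1).
Proof.
move=> z1; apply/eqP; rewrite -subr_eq0 -normc_eq0 eq_le normc_ge0 andbT.
have N1 : (-1 : R) <= 1 by lra.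
have normc1_le : normc (1 : R[i]) <= 1 by rewrite (normc_real 1) normr1.
have key m : normc (sq (fun w => (w - z)^-1) - sq (fun w => w^-1)) <=
    32 * normc z ^+ m.+1.
  have := @sq_expansion (fun=> 1) 1 z m.+1 z1 (fun w _ => cts_cst _ w) _.
  rewrite mulr1 big_ord_recl expr0 mul1r /=.
  rewrite (eq_bint N1 N1 (psi := fun w => (w - z)^-1)); last by move=> w _; rewrite mul1r.
  rewrite (eq_bint (phi := fun w => 1 * _) N1 N1 (psi := fun w => w^-1)); last first.
    by move=> w _; rewrite mul1r expr1.
  rewrite big1 ?addr0; first by apply=> w _; exact: normc1_le.
  move=> j _; rewrite (eq_bint N1 N1 (psi := fun w => w^-1 ^+ j.+2)).
    by rewrite sq_invX mulr0.
  by move=> w _; rewrite mul1r.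
rewrite leNgt; apply/negP => D0.
have [k Hk] := halving_small (divr_gt0 D0 (ltr0n _ 32)).
have := key k; apply/negP; rewrite -ltNge.
move: Hk; rewrite ltr_pdivlMr // mulrC; apply: le_lt_trans.
rewrite ler_wpM2l // exprS -[leRHS]mul1r ler_pM ?exprn_ge0 ?normc_ge0 //; first by lra.
by rewrite lerXn2r ?nnegrE ?normc_ge0 // -div1r.
Qed.

Lemma derivable_quotient (F : R[i]^o -> R[i]^o) (z w : R[i]^o) : w != z ->
  derivable F w 1 -> derivable (fun y => (F y - F z) * (y - z)^-1) w 1.
Proof.
move=> wz dF.
have d1 : derivable (fun y => F y - F z) w 1.
  exact: (derivableB dF (derivable_cst _ _ _)).
have d2 : derivable (fun y : R[i]^o => y - z) w 1.
  apply/(cdiffableP (fun y => y - z)); exists 1.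
  have := cdiff_linear 0 1 z w.
  by rewrite (_ : (fun _ => _) = fun y => y - z) //; apply/funext => y; rewrite add0r mul1r.
have d3 : derivable (fun y : R[i]^o => (y - z)^-1) w 1.
  by apply: (@derivableV _ _ (fun y : R[i]^o => y - z) w 1 _ d2); rewrite subr_eq0.
exact: (derivableM d1 d3).
Qed.

(** Near z the quotient is bounded by 1 + |l|. [goursat_hole] replaces the contour by a square of
    half-side [e] around z, whose contribution is of order [e]. *)
Lemma sq_quotient phi z : normc z <= 1 / 2 ->
  (forall w, -1 <= Re w <= 1 -> -1 <= Im w <= 1 -> exists l, cdiff phi w l) ->
  sq (fun w => (phi w - phi z) * (w - z)^-1) = 0.
Proof.
move=> z1 dphi; pose g w := (phi w - phi z) * (w - z)^-1.
have /andP[p1 p2] : - (1 / 2) <= Re z <= 1 / 2.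
  by rewrite -ler_norml; exact: le_trans (normc_Re z) z1.
have /andP[q1 q2] : - (1 / 2) <= Im z <= 1 / 2.
  by rewrite -ler_norml; exact: le_trans (normc_Im z) z1.
have dg w : -1 <= Re w <= 1 -> -1 <= Im w <= 1 -> w != z -> exists l, cdiff g w l.
  move=> w1 w2 wz; apply/cdiffableP.
  by apply: (@derivable_quotient phi z w) => //; apply/cdiffableP; exact: dphi.
have [l dl] : exists l, cdiff phi z l by apply: dphi; apply/andP; split; lra.
have [r r0 Hr] := dl _ ltr01.
have B0 : 0 < 1 + normc l by rewrite ltr_wpDr ?normc_ge0.
apply/eqP; rewrite -normc_eq0 eq_le normc_ge0 andbT.
apply/ler_addgt0Pl => x x0; rewrite addr0.
(* The constraints keep the small square inside [-1, 1]^2 and inside the disc where the derivative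
   estimate holds, and its integral below [x]. *)
have [e [e0 e1 er ex]] : exists e : R, [/\ 0 < e, e <= 1 / 4, 2 * e < r &
    (1 + normc l) * (e *+ 4) *+ 4 <= x].
  have x16 : 0 < x / (16 * (1 + normc l)) by rewrite divr_gt0 // mulr_gt0.
  exists (Num.min (1 / 4) (Num.min (r / 4) (x / (16 * (1 + normc l))))).
  split; first by rewrite !lt_min x16 !divr_gt0.
  - by rewrite ge_min lexx.
  - apply: le_lt_trans (_ : 2 * (r / 4) < r); last by lra.
    by rewrite ler_wpM2l // !ge_min lexx orbT.
  - set m := Num.min _ _.
    have : m <= x / (16 * (1 + normc l)) by rewrite !ge_min lexx !orbT.
    rewrite ler_pdivlMr ?mulr_gt0 //; apply: le_trans.
    by rewrite -[m *+ 4]mulr_natr -[_ *+ 4 in leLHS]mulr_natr; nra.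
have -> : sq g = bint g (Re z - e) (Re z + e) (Im z - e) (Im z + e).
  apply: goursat_hole; [exact: e0|lra|lra|lra|lra|] => w w1 w2 wz.
  by apply: dg => //; case: (z) wz.
have [pe qe] : Re z - e <= Re z + e /\ Im z - e <= Im z + e by split; lra.
have smallbnd w : bnd (Re z - e) (Re z + e) (Im z - e) (Im z + e) w ->
    [/\ -1 <= Re w <= 1, -1 <= Im w <= 1, w != z & normc (w - z) < r].
  move=> wb; have [/andP[w1 w2] /andP[w3 w4]] := bnd_box pe qe wb.
  split; [by apply/andP; split; lra|by apply/andP; split; lra| |].
    apply/eqP => E; case: wb; rewrite E => -[_ [] E2]; lra.
  apply: le_lt_trans (normc_le_ReIm _) _; apply: le_lt_trans er.
  rewrite mulr_natl mulr2n; apply: lerD.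
    rewrite (_ : Re (w - z) = Re w - Re z); last by case: (w); case: (z).
    by rewrite ler_norml; apply/andP; split; lra.
  rewrite (_ : Im (w - z) = Im w - Im z); last by case: (w); case: (z).
  by rewrite ler_norml; apply/andP; split; lra.
apply: le_trans ex.
have -> : e *+ 4 = (Re z + e - (Re z - e)) + (Im z + e - (Im z - e)).
  by rewrite -mulr_natr; ring.
apply: bint_bound => //.
  by move=> w /smallbnd[w1 w2 wz _]; have [l' /cdiff_cts] := dg w w1 w2 wz.
move=> w /smallbnd[_ _ wz wr].
have wz0 : 0 < normc (w - z) by rewrite normc_gt0 subr_eq0.
rewrite /g normcM normcV ler_pdivrMr // mulrDl.
rewrite -[phi w - phi z](subrK (l * (w - z))).
apply: le_trans (le_normcD _ _) _; rewrite normcM lerD2r; exact: Hr.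
Qed.

Lemma cauchy_square phi z : normc z <= 1 / 2 ->
  (forall w, -1 <= Re w <= 1 -> -1 <= Im w <= 1 -> exists l, cdiff phi w l) ->
  sq (fun w => phi w * (w - z)^-1) = phi z * sq (fun w => w^-1).
Proof.
move=> z1 dphi; have N1 : (-1 : R) <= 1 by lra.
have cphi w : bsq w -> cts phi w.
  by move=> /(bnd_box N1 N1)[w1 w2]; have [l /cdiff_cts] := dphi w w1 w2.
have ci : bcts (fun w => (w - z)^-1) (-1) 1 (-1) 1.
  by move=> w bw; apply: cts_inv; case: (bsq_neq bw z1).
rewrite -(sq_inv_shift z1) -bintZ // -[RHS]add0r -(sq_quotient z1 dphi) -bintD.
- by apply: eq_bint => // w _; rewrite -mulrDl subrK.
- move=> w bw; apply: ctsM (ci w bw); apply: ctsD (cphi w bw) (cts_cst _ _).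
- by move=> w bw; apply: ctsZ; exact: ci.
Qed.

(** The coefficients are Cauchy's, with the integral of 1 / w in the place of 2 pi i. One constant
    serves every order [k], so the expansion is used through its remainders and no series is
    summed. *)
Lemma taylor_square phi M :
  (forall w, -1 <= Re w <= 1 -> -1 <= Im w <= 1 ->
     (exists l, cdiff phi w l) /\ normc (phi w) <= M) ->
  exists c : nat -> R[i], forall k z, normc z <= 1 / 2 ->
    normc (phi z - \sum_(j < k) c j * z ^+ j) <=
    32 / normc (sq (fun w => w^-1)) * M * normc z ^+ k.
Proof.
move=> H; have N1 : (-1 : R) <= 1 by lra.
set K := sq _; have K0 : K != 0 by exact: sq_inv_neq0.
exists (fun j => sq (fun w => phi w * w^-1 ^+ j.+1) / K) => k z z1.
have cphi : bcts phi (-1) 1 (-1) 1.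
  by move=> w /(bnd_box N1 N1)[w1 w2]; have [[l /cdiff_cts]] := H w w1 w2.
have HM w : bsq w -> normc (phi w) <= M.
  by move=> /(bnd_box N1 N1)[w1 w2]; have [] := H w w1 w2.
have := sq_expansion k z1 cphi HM.
rewrite cauchy_square //; last by move=> w w1 w2; case: (H w w1 w2).
rewrite -/K => E.
rewrite [X in normc X](_ : _ = K^-1 * (phi z * K -
    \sum_(j < k) z ^+ j * sq (fun w => phi w * w^-1 ^+ j.+1))); last first.
  rewrite mulrBr mulrCA mulVf // mulr1; congr (_ - _).
  by rewrite mulr_sumr; apply: eq_bigr => j _; rewrite mulrAC mulrC [_ * z ^+ j]mulrC.
rewrite normcM normcV mulrC -!mulrA [_^-1 * _]mulrC !mulrA.
by rewrite ler_wpM2r // invr_ge0 normc_ge0.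
Qed.

End Cauchy.

(** * Taylor expansion and order of vanishing in one variable *)

Section Disc.
Variable R : realType.
Implicit Types (phi : R[i]^o -> R[i]^o) (rho M : R) (t : R[i]).

Definition disc_bounded phi rho M : Prop :=
  0 < rho /\ forall t, normc t < rho -> derivable phi t 1 /\ normc (phi t) <= M.

(** [C] is fixed before [phi]; this makes later remainders uniform over all points and
    directions. *)
Lemma taylor_disc : exists2 C : R, 0 < C &
  forall phi rho M, disc_bounded phi rho M ->
  exists c : nat -> R[i], forall k t, normc t <= rho / 6 ->
    normc (phi t - \sum_(j < k) c j * t ^+ j) <= C * M * (3 * normc t / rho) ^+ k.
Proof.
exists (32 / normc (bint (fun w : R[i] => w^-1) (-1) 1 (-1) 1)).
  by rewrite divr_gt0 // normc_gt0 sq_inv_neq0.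
(* Points of the square have modulus at most 2, so scaling by [rho / 3] maps it into the disc, and
   the range [normc z <= 1 / 2] becomes [normc t <= rho / 6]. *)
move=> phi rho M [rho0 H]; pose s : R[i] := (rho / 3)%:C.
have s0 : s != 0 by rewrite -normc_gt0 normc_real normr_gt0 gt_eqF // divr_gt0.
have ns : normc s = rho / 3 by rewrite normc_real ger0_norm // ltW // divr_gt0.
have [|c Hc] := @taylor_square R (fun w => phi (s * w)) M.
  move=> w w1 w2.
  have sw : normc (s * w) < rho.
    have wn : normc w <= 2.
      apply: le_trans (normc_le_ReIm _) _; rewrite (_ : 2 = 1 + 1) //.
      by apply: lerD; rewrite ler_norml.
    rewrite normcM ns; apply: le_lt_trans (_ : rho / 3 * 2 < _); last by lra.
    by rewrite ler_wpM2l // ltW // divr_gt0.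
  have [/cdiffableP[l dl] bM] := H _ sw; split => //; exists (s * l) => e e0.
  have [r r0 Hr] := dl (e / normc s) ltac:(by rewrite divr_gt0 // normc_gt0).
  have ns0 : 0 < normc s by rewrite normc_gt0.
  exists (r / normc s); first by rewrite divr_gt0.
  move=> y; rewrite ltr_pdivlMr // => yr.
  have E0 : s * y - s * w = s * (y - w) by rewrite mulrBr.
  have E1 : l * (s * (y - w)) = s * l * (y - w) by ring.
  have E2 : e / normc s * (normc (y - w) * normc s) = e * normc (y - w).
    by field; rewrite gt_eqF.
  by have := Hr (s * y); rewrite E0 E1 normcM [normc s * _]mulrC E2; apply.
exists (fun j => c j / s ^+ j) => k t tr.
have := Hc k (t / s); rewrite normcM normcV ns mulrCA mulfV // mulr1.
have -> : normc t * (rho / 3)^-1 = 3 * normc t / rho.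
  by field; rewrite gt_eqF.
rewrite (eq_bigr (fun j : 'I_k => c j / s ^+ j * t ^+ j)); last first.
  by move=> j _; rewrite exprMn exprVn mulrAC mulrA.
apply; rewrite ler_pdivrMr //; lra.
Qed.

Lemma geometric_zero (x y q : R) : 0 <= x -> 0 <= q <= 1 / 2 ->
  (forall k, x <= y * q ^+ k) -> x = 0.
Proof.
move=> x0 /andP[q0 q1] H; apply/eqP; rewrite eq_le x0 andbT leNgt; apply/negP => xp.
have y0 : 0 < y by have := H 0%N; rewrite expr0 mulr1; apply: lt_le_trans.
have [k Hk] := halving_small (divr_gt0 xp y0).
have := H k; apply/negP; rewrite -ltNge.
move: Hk; rewrite ltr_pdivlMr // mulrC; apply: le_lt_trans.
by rewrite ler_pM2l // lerXn2r ?nnegrE // -div1r.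
Qed.

Lemma taylor_first_order : exists2 C : R, 0 < C &
  forall phi rho M l, disc_bounded phi rho M -> is_derive (0 : R[i]^o) 1 phi (l : R[i]^o) ->
  forall t, normc t <= rho / 6 ->
    normc (phi t - phi 0 - t * l) <= C * M * (normc t / rho) ^+ 2.
Proof.
have [C C0 HC] := taylor_disc.
exists (C * 9); first by rewrite mulr_gt0.
move=> phi rho M l H dl t tr; have [c Hc] := HC _ _ _ H.
have [rho0 H2] := H.
have M0 : 0 <= M.
  by have [|_ ] := H2 0; rewrite ?normc0 //; apply: le_trans; exact: normc_ge0.
have n0 : normc (0 : R[i]) <= rho / 6 by rewrite normc0 divr_ge0 // ltW.
have c0 : phi 0 = c 0%N.
  have := Hc 1%N 0 n0; rewrite normc0 mulr0 mul0r expr1 mulr0 big_ord1 expr0 mulr1 => h.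
  by apply/eqP; rewrite -subr_eq0 -normc_eq0 eq_le h normc_ge0.
have E k : C * M * (3 * k / rho) ^+ 2 = C * 9 * M * (k / rho) ^+ 2.
  by rewrite -mulrA exprMn; ring.
(* The expansion of order 2 and the definition of the derivative at 0 are compared at one small real
   [h]; their linear coefficients then differ by at most [e]. *)
suff -> : l = c 1%N.
  have := Hc 2%N t tr; rewrite big_ord_recl big_ord1 expr0 mulr1 /= -c0 expr1 E.
  by rewrite opprD addrA [c 1%N * _]mulrC.
apply/eqP; rewrite -subr_eq0 -normc_eq0 eq_le normc_ge0 andbT.
apply/ler_addgt0Pl => e e0; rewrite addr0.
have e20 : 0 < e / 2 by rewrite divr_gt0.
have [d d0 Hd] := (is_derive_realP _ _ _ _).1 dl _ e20.
pose K := C * 9 * M / rho ^+ 2.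
have K0 : 0 <= K by rewrite divr_ge0 ?exprn_ge0 ?mulr_ge0 // ltW.
have [h [h0 hd hr hK]] : exists h : R, [/\ 0 < h, h < d, h <= rho / 6 & K * h <= e / 2].
  have x0 : 0 < e / 2 / (K + 1) by rewrite divr_gt0 // ltr_wpDl.
  exists (Num.min (d / 2) (Num.min (rho / 6) (e / 2 / (K + 1)))); split.
  - by rewrite !lt_min x0 !divr_gt0.
  - by apply: le_lt_trans (_ : d / 2 < d); [rewrite ge_min lexx|lra].
  - by rewrite !ge_min lexx orbT.
  - set m := Num.min _ _.
    have m1 : m <= e / 2 / (K + 1) by rewrite !ge_min lexx !orbT.
    move: m1; rewrite ler_pdivlMr ?ltr_wpDl // => m1.
    have m0 : 0 < m by rewrite !lt_min x0 !divr_gt0.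
    by apply: le_trans m1; rewrite mulrC ler_wpM2l ?lerDl // ltW.
have nh : normc h%:C = h by rewrite normc_real gtr0_norm.
have h1 := Hd h%:C; rewrite nh [_ *: _](_ : _ = h%:C) in h1; last first.
  by rewrite /GRing.scale /= mulr1.
have {}h1 := h1 hd; rewrite addr0 in h1.
have := Hc 2%N h%:C; rewrite nh big_ord_recl big_ord1 expr0 mulr1 /= -c0 expr1 E => /(_ hr) h2.
rewrite -(ler_pM2r h0) -{1}nh -normcM.
rewrite (_ : _ * _ = (phi h%:C - (phi 0 + c 1%N * h%:C)) - (phi h%:C - phi 0 - h%:C * l)); last by ring.
apply: le_trans (le_normcD _ _) _; rewrite normcN.
apply: le_trans (lerD h2 h1) _.
have -> : e * h = (e / 2) * h + e / 2 * h by field.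
rewrite lerD2r; have -> : C * 9 * M * (h / rho) ^+ 2 = K * h * h.
  by rewrite /K; field; rewrite gt_eqF.
by rewrite ler_wpM2r // ltW.
Qed.

(** If all Taylor coefficients vanish, the remainder bounds decay geometrically on the disc of
    radius [rho / 6]. Otherwise k is the least index with a nonzero coefficient, and the remainder
    of order k + 1 gives the limit. *)
Lemma order_dichotomy phi rho M : disc_bounded phi rho M ->
  (forall t, normc t <= rho / 6 -> phi t = 0) \/
  exists k (c : R[i]), c != 0 /\ forall e : R, 0 < e -> exists2 d : R, 0 < d &
    forall t, t != 0 -> normc t < d -> normc (phi t / t ^+ k - c) < e.
Proof.
move=> H; have [C C0 HC] := taylor_disc; have [c Hc] := HC _ _ _ H.
have [rho0 H2] := H.
have M0 : 0 <= M.
  by have [|_ ] := H2 0; rewrite ?normc0 //; apply: le_trans; exact: normc_ge0.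
have [all0|/existsNP[k0 /eqP ck0]] := pselect (forall j, c j = 0).
  left=> t tr; apply/eqP; rewrite -normc_eq0; apply/eqP.
  apply: (@geometric_zero _ (C * M) (3 * normc t / rho)); rewrite ?normc_ge0 //.
    rewrite divr_ge0 ?mulr_ge0 ?normc_ge0 ?(ltW rho0) //= ler_pdivrMr //; lra.
  move=> k; have := Hc k t tr; rewrite big1 ?subr0 // => j _.
  by rewrite all0 mul0r.
right; have ex : exists k, c k != 0 by exists k0.
case: (ex_minnP ex) => k ck kmin; exists k, (c k); split => // e e0.
pose K := C * M * (3 / rho) ^+ k.+1.
have K0 : 0 <= K by rewrite mulr_ge0 ?exprn_ge0 ?divr_ge0 ?mulr_ge0 // ltW.
exists (Num.min (rho / 6) (e / (K + 1))).
  by rewrite lt_min !divr_gt0 // ltr_wpDl.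
move=> t t0; rewrite lt_min => /andP[/ltW tr]; rewrite ltr_pdivlMr ?ltr_wpDl // => te.
have tp : 0 < normc t by rewrite normc_gt0.
have := Hc k.+1 t tr; rewrite big_ord_recr big1 /=; last first.
  move=> j _; have [->|/kmin] := eqVneq (c j) 0; first by rewrite mul0r.
  by rewrite leqNgt ltn_ord.
rewrite add0r => h.
have tk : t ^+ k != 0 by rewrite expf_neq0.
rewrite (_ : _ - _ = (phi t - c k * t ^+ k) / t ^+ k); last by field.
rewrite normcM normcV normcX ltr_pdivrMr ?exprn_gt0 //.
apply: le_lt_trans h _.
have -> : C * M * (3 * normc t / rho) ^+ k.+1 = K * normc t * normc t ^+ k.
  have -> : 3 * normc t / rho = (3 / rho) * normc t by ring.
  by rewrite exprMn [normc t ^+ k.+1]exprS /K; ring.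
rewrite ltr_pM2r ?exprn_gt0 //; apply: le_lt_trans te.
by rewrite mulrC ler_wpM2l ?lerDl // ltW.
Qed.

(** A nonzero leading term c t^k would contradict the bound of order k + 1 near 0. *)
Lemma flat_zero phi rho M : disc_bounded phi rho M ->
  (forall k, exists B d : R, 0 < d /\
     forall t, normc t < d -> normc (phi t) <= B * normc t ^+ k) ->
  forall t, normc t <= rho / 6 -> phi t = 0.
Proof.
move=> /order_dichotomy[//|[k [c [c0 Hc]]]] Hflat; exfalso.
have [B [d [d0 Hd]]] := Hflat k.+1.
have nc0 : 0 < normc c by rewrite normc_gt0.
have [r r0 Hr] := Hc (normc c / 2) ltac:(by rewrite divr_gt0).
have B0 : 0 < `|B| + 1 by rewrite ltr_wpDl.
pose h := Num.min (d / 2) (Num.min (r / 2) (normc c / 2 / (`|B| + 1))).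
have h0 : 0 < h by rewrite !lt_min !divr_gt0.
have nh : normc h%:C = h by rewrite normc_real gtr0_norm.
have hn0 : h%:C != 0 by rewrite -normc_gt0 nh.
have hd : h < d by apply: le_lt_trans (_ : d / 2 < d); [rewrite ge_min lexx|lra].
have hr : h < r.
  by apply: le_lt_trans (_ : r / 2 < r); [rewrite !ge_min lexx !orbT|lra].
have hB : h * (`|B| + 1) <= normc c / 2 by rewrite -ler_pdivlMr // !ge_min lexx !orbT.
have := Hr _ hn0; rewrite nh => /(_ hr) h1.
have := Hd h%:C; rewrite nh => /(_ hd) h2.
have h3 : normc (phi h%:C / h%:C ^+ k) <= normc c / 2.
  rewrite normcM normcV normcX nh ler_pdivrMr ?exprn_gt0 //.
  apply: le_trans h2 _; rewrite exprS mulrA ler_pM2r ?exprn_gt0 //.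
  apply: le_trans hB; rewrite mulrC ler_pM2l //.
  by apply: le_trans (ler_norm _) _; rewrite lerDl.
have : normc c <= normc (phi h%:C / h%:C ^+ k - c) + normc (phi h%:C / h%:C ^+ k).
  rewrite normcB -{1}(subrK (phi h%:C / h%:C ^+ k) c); exact: le_normcD.
by apply/negP; rewrite -ltNge; lra.
Qed.

End Disc.

(** * Holomorphy in several variables along lines *)

Section RealNorm.
Variables (R : realType) (V : normedModType R[i]).
Implicit Types x y v : V.

Definition rnorm v : R := Re `|v|.

Lemma rnormE v : `|v| = (rnorm v)%:C.
Proof. by rewrite /rnorm RRe_real // normr_real. Qed.

Lemma rnorm_ge0 v : 0 <= rnorm v.
Proof. by rewrite -lecR -rnormE normr_ge0. Qed.

Lemma rnorm0 : rnorm 0 = 0.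
Proof. by rewrite /rnorm normr0. Qed.

Lemma rnormD x y : rnorm (x + y) <= rnorm x + rnorm y.
Proof. by rewrite -lecR rmorphD /= -!rnormE ler_normD. Qed.

Lemma rnormZ (a : R[i]) v : rnorm (a *: v) = normc a * rnorm v.
Proof. by apply: (@complexI R); rewrite rmorphM /= -!rnormE normrZ. Qed.

Lemma rnorm_triangle x y z : rnorm (x - z) <= rnorm (x - y) + rnorm (y - z).
Proof.
have -> : x - z = (x - y) + (y - z) by rewrite addrA subrK.
exact: rnormD.
Qed.

Lemma nbhs_rnormP x (P : set V) :
  nbhs x P <-> exists2 d : R, 0 < d & forall y, rnorm (y - x) < d -> P y.
Proof.
by split=> [/nbhs_realP[d d0 H]|[d d0 H]]; [|apply/nbhs_realP]; exists d => // y h;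
  apply: H; move: h; rewrite rnormE ltcR.
Qed.

Lemma continuous_rnormP (F : V -> R[i]^o) x :
  {for x, continuous F} <->
  (forall e : R, 0 < e -> exists2 d : R, 0 < d &
    forall y, rnorm (y - x) < d -> normc (F y - F x) < e).
Proof.
split=> [/continuous_realP H e /H|H].
  by move=> [d d0 Hd]; exists d => // y yx; rewrite -ltcR; apply: Hd; rewrite rnormE ltcR.
apply/continuous_realP => e /H[d d0 Hd]; exists d => // y yx.
have : normc (F y - F x) < e by apply: Hd; move: yx; rewrite rnormE ltcR.
by rewrite -ltcR.
Qed.

(** The quadratic remainder gives the little-o condition; the linear bound supplies the continuity
    of the differential, which linearity alone does not give in an arbitrary normed module. *)
Lemma differentiable_quadratic (F : V -> R[i]^o) x (L : V -> R[i]^o) (K d : R) :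
  linear L -> 0 < d ->
  (forall v, normc (L v) <= K * rnorm v) ->
  (forall v, rnorm v < d -> normc (F (v + x) - F x - L v) <= K * rnorm v ^+ 2) ->
  differentiable F x.
Proof.
move=> linL d0 bL HF.
pose df : {linear V -> R[i]^o} := HB.pack L (GRing.isLinear.Build _ _ _ _ L linL).
have K0 : 0 <= `|K| by [].
have K1 : 0 < `|K| + 1 by rewrite ltr_wpDl.
have KK : K <= `|K| + 1 by apply: le_trans (ler_norm _) _; rewrite lerDl.
have cdf : continuous df.
  move=> y; apply/continuous_rnormP => e e0; exists (e / (`|K| + 1)).
    by rewrite divr_gt0.
  move=> z; rewrite ltr_pdivlMr // => zy.
  have -> : df z - df y = df (z - y) by rewrite linearB.
  apply: le_lt_trans (bL _) _; apply: le_lt_trans zy.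
  by rewrite mulrC ler_wpM2l ?rnorm_ge0.
have E : F \o shift x = cst (F x) + df +o_ 0 id.
  apply/eqaddoP => _ /gt0_complexP[e e0 ->].
  apply/nbhs_rnormP; exists (Num.min d (e / (`|K| + 1))).
    by rewrite lt_min d0 divr_gt0.
  move=> v; rewrite subr0 lt_min => /andP[/HF h]; rewrite ltr_pdivlMr // => ve.
  have h2 : normc (F (v + x) - F x - L v) <= e * rnorm v.
    apply: le_trans h _; rewrite expr2 mulrA ler_wpM2r ?rnorm_ge0 //.
    apply: le_trans (ltW ve); rewrite mulrC ler_wpM2l ?rnorm_ge0 //.
  rewrite [`|id v|]rnormE -rmorphM /=.
  have -> : (F \o shift x - (cst (F x) + df)) v = F (v + x) - F x - L v.
    have E0 (p q r : R[i]) : p - (q + r) = p - q - r by ring.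
    exact: E0.
  by have := h2; rewrite -lecR.
have dE := diff_unique cdf E.
by apply/diff_locallyP; rewrite dE.
Qed.

Lemma is_derive_line (F : V -> R[i]^o) x v (s : R[i]) l :
  is_derive (s *: v + x) v F (l : R[i]^o) <->
  is_derive (s : R[i]^o) 1 (fun t : R[i]^o => F (t *: v + x)) (l : R[i]^o).
Proof.
have E (h : R[i]) : h *: v + (s *: v + x) = (h *: (1 : R[i]^o) + s) *: v + x.
  rewrite scalerDl -addrA; congr (_ *: _ + _).
  by rewrite /GRing.scale /= mulr1.
split=> /is_derive_realP H; apply/is_derive_realP => e /H[d d0 Hd]; exists d => // h /Hd;
  by rewrite E.
Qed.

Lemma derivable_line (F : V -> R[i]^o) x v (s : R[i]) :
  derivable F (s *: v + x) v <-> derivable (fun t : R[i]^o => F (t *: v + x)) s 1.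
Proof. by split=> /derivableP/is_derive_line[]. Qed.

Lemma derive_homogeneous (F : V -> R[i]^o) x v (a : R[i]) : derivable F x v ->
  'D_(a *: v) F x = a * 'D_v F x.
Proof.
move=> /derivableP/is_derive_realP H.
have : is_derive x (a *: v) F (a * 'D_v F x : R[i]^o).
  apply/is_derive_realP => e e0.
  have a1 : 0 < normc a + 1 by rewrite ltr_wpDl ?normc_ge0.
  have [d d0 Hd] := H (e / (normc a + 1)) ltac:(by rewrite divr_gt0).
  exists (d / (normc a + 1)); first by rewrite divr_gt0.
  move=> h; rewrite ltr_pdivlMr // => hd; rewrite scalerA mulrA.
  have ha : normc (h * a) <= normc h * (normc a + 1).
    by rewrite normcM ler_wpM2l ?normc_ge0 ?lerDl.
  apply: le_trans (Hd _ (le_lt_trans ha hd)) _.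
  apply: le_trans (_ : e / (normc a + 1) * (normc h * (normc a + 1)) <= _).
    by rewrite ler_wpM2l // ltW // divr_gt0.
  by rewrite mulrA mulrAC divfK ?gt_eqF.
by move=> [_ <-].
Qed.

End RealNorm.

Local Ltac nonneg := repeat first [ done | exact: normc_ge0 | exact: rnorm_ge0
  | exact: ltW | apply: exprn_ge0 | apply: divr_ge0 | apply: mulr_ge0
  | apply: addr_ge0 ].

Section Small.
Variable R : realType.

Lemma exists_small (a b c d : R) : 0 < a -> 0 < b -> 0 < c -> 0 < d ->
  exists h, [/\ 0 < h, h <= a, h <= b, h <= c & h <= d].
Proof.
move=> a0 b0 c0 d0; exists (Num.min (Num.min a b) (Num.min c d)); split.
- by rewrite !lt_min a0 b0 c0.
- by rewrite !ge_min lexx.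
- by rewrite !ge_min lexx !orbT.
- by rewrite !ge_min lexx !orbT.
- by rewrite !ge_min lexx !orbT.
Qed.

Lemma mul_small (h k b : R) : 0 < h -> 0 <= k -> h <= b / (k + 1) -> h * k < b.
Proof.
move=> h0 k0; rewrite ler_pdivlMr ?ltr_wpDl // => /lt_le_trans; apply.
by rewrite ltr_pM2l // ltrDl.
Qed.

Lemma divr_gt01 (b k : R) : 0 < b -> 0 <= k -> 0 < b / (k + 1).
Proof. by move=> b0 k0; rewrite divr_gt0 // ltr_wpDl. Qed.

(* The limit is the supremum of q s - K |s|, a substitute for Cauchy completeness. *)
Lemma real_limit_at0 (q : R[i] -> R) (K d : R) : 0 < d ->
  (forall s t, s != 0 -> t != 0 -> normc s < d -> normc t < d ->
     q s - q t <= K * (normc s + normc t)) ->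
  exists l, forall s, s != 0 -> normc s < d -> `|q s - l| <= K * normc s.
Proof.
move=> d0 H; pose S := [set y | exists s, [/\ s != 0, normc s < d & y = q s - K * normc s]].
have S0 : S !=set0.
  have nd : normc (d / 2)%:C = d / 2 by rewrite normc_real ger0_norm // ltW // divr_gt0.
  exists (q (d / 2)%:C - K * normc (d / 2)%:C); exists (d / 2)%:C; split => //.
    by rewrite -normc_gt0 nd divr_gt0.
  by rewrite nd; lra.
have ubS t : t != 0 -> normc t < d -> ubound S (q t + K * normc t).
  move=> t0 td _ [s [s0 sd ->]]; have := H s t s0 t0 sd td; rewrite mulrDr; lra.
exists (sup S) => s s0 sd; rewrite ler_norml; apply/andP; split.
  have : sup S <= q s + K * normc s by apply: ge_sup => //; exact: ubS.
  lra.
have : q s - K * normc s <= sup S.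
  apply: ub_le_sup; first by exists (q s + K * normc s); exact: ubS.
  by exists s.
lra.
Qed.

Lemma limit_at0 (Q : R[i] -> R[i]) (K d : R) : 0 < d ->
  (forall s t, s != 0 -> t != 0 -> normc s < d -> normc t < d ->
     normc (Q s - Q t) <= K * (normc s + normc t)) ->
  exists l, forall s, s != 0 -> normc s < d -> normc (Q s - l) <= 2 * K * normc s.
Proof.
move=> d0 H.
have [|l1 H1] := @real_limit_at0 (fun s => Re (Q s)) K d d0.
  move=> s t s0 t0 sd td; apply: le_trans (H s t s0 t0 sd td).
  apply: le_trans (normc_Re _); apply: le_trans (ler_norm _).
  by case: (Q s); case: (Q t).
have [|l2 H2] := @real_limit_at0 (fun s => Im (Q s)) K d d0.
  move=> s t s0 t0 sd td; apply: le_trans (H s t s0 t0 sd td).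
  apply: le_trans (normc_Im _); apply: le_trans (ler_norm _).
  by case: (Q s); case: (Q t).
exists (l1 +i* l2) => s s0 sd; apply: le_trans (normc_le_ReIm _) _.
have -> : 2 * K * normc s = K * normc s + K * normc s by ring.
have := H1 s s0 sd; have := H2 s s0 sd; case: (Q s) => a b /= h2 h1.
exact: lerD.
Qed.

End Small.

(** * From holomorphy on lines to Frechet differentiability *)

Section Gateaux.
Variables (R : realType) (V : normedModType R[i]).
Implicit Types (F : V -> R[i]^o) (x v : V) (r M : R).

(** Gateaux holomorphy with an explicit radius and bound: Taylor remainders along complex lines then
    depend on F only through [r] and [M]. *)
Definition gateaux_ball F x0 r M : Prop := 0 < r /\ forall x, rnorm (x - x0) < r ->
  [/\ {for x, continuous F}, forall v, derivable F x v & normc (F x) <= M].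

Definition gateaux_holo F x : Prop :=
  \forall y \near x, {for y, continuous F} /\ forall v, derivable F y v.

Lemma gateaux_holo_gateaux_ball F x : gateaux_holo F x -> exists r M, gateaux_ball F x r M.
Proof.
move=> gF; have [cF _] := nbhs_singleton gF.
have [d d0 Hd] := (continuous_rnormP _ _).1 cF _ ltr01.
have [e e0 He] := (nbhs_rnormP _ _).1 gF.
exists (Num.min d e), (1 + normc (F x)); split; first by rewrite lt_min d0.
move=> y; rewrite lt_min => /andP[/Hd yd /He[cy dy]]; split => //.
rewrite -[F y](subrK (F x)); apply: le_trans (le_normcD _ _) _.
by rewrite lerD2r ltW.
Qed.

Lemma gateaux_ball_ge0 F x0 r M : gateaux_ball F x0 r M -> 0 <= M.
Proof.
move=> [r0 H]; have [|_ _] := H x0; first by rewrite subrr rnorm0.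
exact: le_trans (normc_ge0 _).
Qed.

Lemma gateaux_ball_remainder : exists2 C : R, 0 < C &
  forall F x0 r M, gateaux_ball F x0 r M -> forall x v (t : R[i]),
    rnorm (x - x0) < r / 2 -> normc t * rnorm v <= r / 12 ->
    normc (F (t *: v + x) - F x - t * 'D_v F x) <=
      C * M * (rnorm v / r) ^+ 2 * normc t ^+ 2.
Proof.
have [C C0 HC] := taylor_first_order R; exists (C * 4); first by rewrite mulr_gt0.
move=> F x0 r M gF x v t xr tv; have M0 := gateaux_ball_ge0 gF; have [r0 H] := gF.
have [v0|v0] := eqVneq v 0.
  rewrite v0 scaler0 add0r derive0 subrr sub0r mulr0 oppr0 normc0.
  by nonneg.
have nv : 0 < rnorm v by rewrite -ltcR -rnormE normr_gt0.
(* From a point within [r / 2] of [x0] the line stays in the ball while [normc t < rho]; the Taylor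
   range [rho / 6] is the bound [r / 12] on [normc t * rnorm v]. *)
pose rho := r / 2 / rnorm v; have rho0 : 0 < rho by rewrite !divr_gt0.
have inr s : normc s < rho -> rnorm ((s *: v + x) - x0) < r.
  rewrite ltr_pdivlMr // => sv; rewrite -addrA.
  apply: le_lt_trans (rnormD _ _) _; rewrite rnormZ; lra.
have db : disc_bounded (fun s : R[i]^o => F (s *: v + x)) rho M.
  split => // s /inr/H[_ dF bF]; split => //; exact/derivable_line.
have dx : is_derive (0 : R[i]^o) 1 (fun s : R[i]^o => F (s *: v + x)) ('D_v F x : R[i]^o).
  apply/is_derive_line; rewrite scale0r add0r; apply/derivableP.
  by have [|_ dF _] := H x; [lra|exact: dF].
have := HC _ _ _ _ db dx t; rewrite scale0r add0r.
have -> : C * M * (normc t / rho) ^+ 2 = C * 4 * M * (rnorm v / r) ^+ 2 * normc t ^+ 2.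
  by rewrite /rho; field; rewrite !gt_eqF.
apply; rewrite /rho mulrAC ler_pdivlMr //; lra.
Qed.

(** Derivatives at x and y are compared through difference quotients with one step [h], chosen first
    so that the remainders K h^2 stay below e h / 4; continuity of F at x and at x + h v then
    controls the quotients. *)
Lemma gateaux_ball_derive_continuous F x0 r M v x : gateaux_ball F x0 r M -> rnorm (x - x0) < r / 2 ->
  {for x, continuous ('D_v F : V -> R[i]^o)}.
Proof.
have [C C0 HC] := gateaux_ball_remainder.
move=> gF xr; have M0 := gateaux_ball_ge0 gF; have [r0 H] := gF.
pose K := C * M * (rnorm v / r) ^+ 2.
have K0 : 0 <= K by rewrite /K; nonneg.
apply/continuous_rnormP => e e0.
have [h [h0 hv hK _ _]] := exists_small (divr_gt01 (divr_gt0 r0 (ltr0n _ 12)) (rnorm_ge0 v))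
  (divr_gt01 (divr_gt0 e0 (ltr0n _ 4)) K0) ltr01 ltr01.
have {}hv := mul_small h0 (rnorm_ge0 v) hv; have {}hK := mul_small h0 K0 hK.
have nh : normc h%:C = h by rewrite normc_real gtr0_norm.
have eh : 0 < e * h / 4 by rewrite divr_gt0 // mulr_gt0.
have [|cx _ _] := H x; first lra.
have [|cy _ _] := H (h%:C *: v + x).
  by rewrite -addrA; apply: le_lt_trans (rnormD _ _) _; rewrite rnormZ nh; lra.
have [d1 d10 Hd1] := (continuous_rnormP _ _).1 cx _ eh.
have [d2 d20 Hd2] := (continuous_rnormP _ _).1 cy _ eh.
have d30 : 0 < r / 2 - rnorm (x - x0) by rewrite subr_gt0.
exists (Num.min d1 (Num.min d2 (r / 2 - rnorm (x - x0)))).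
  by rewrite !lt_min d10 d20.
move=> y; rewrite !lt_min => /and3P[/Hd1 y1 y2 y3].
have {y2}y2 : normc (F (h%:C *: v + y) - F (h%:C *: v + x)) < e * h / 4.
  by apply: Hd2; rewrite opprD addrACA subrr add0r.
have yr : rnorm (y - x0) < r / 2.
  by apply: le_lt_trans (rnorm_triangle _ x _) _; lra.
have := HC _ _ _ _ gF x v h%:C xr; rewrite nh -/K => /(_ (ltW hv)) r1.
have := HC _ _ _ _ gF y v h%:C yr; rewrite nh -/K => /(_ (ltW hv)) r2.
rewrite -(ltr_pM2r h0) -{1}nh -normcM.
set Dy := 'D_v F y in r2 *; set Dx := 'D_v F x in r1 *.
set A := F (h%:C *: v + y) in y2 r2; set B := F (h%:C *: v + x) in y2 r1.
rewrite (_ : _ * _ = ((A - B) - (F y - F x)) + ((B - F x - h%:C * Dx) - (A - F y - h%:C * Dy)));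
  last by ring.
apply: le_lt_trans (le_normcD _ _) _.
apply: le_lt_trans (lerD (le_normcD _ _) (le_normcD _ _)) _; rewrite !normcN.
have hh : K * h ^+ 2 < e * h / 4.
  have -> : K * h ^+ 2 = (h * K) * h by ring.
  have -> : e * h / 4 = (e / 4) * h by field.
  by rewrite ltr_pM2r.
have sum4 (a b c f k q : R) : b < q -> a < q -> c <= k -> f <= k -> k < q ->
    a + b + (c + f) < q * 4 by clear; lra.
have -> : e * h = e * h / 4 * 4 by field.
exact: sum4 y1 y2 r1 r2 hh.
Qed.

(** Going from x to x + h (u + v) directly or through x + h u gives the same increment of F. The
    second leg involves the derivative along v at x + h u, and continuity of that derivative brings
    it back to x. *)
Lemma gateaux_ball_deriveD F x0 r M x u v : gateaux_ball F x0 r M -> rnorm (x - x0) < r / 2 ->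
  'D_(u + v) F x = 'D_u F x + 'D_v F x.
Proof.
have [C C0 HC] := gateaux_ball_remainder.
move=> gF xr; have M0 := gateaux_ball_ge0 gF; have [r0 H] := gF.
have [[ru0 rv0] ruv] := (rnorm_ge0 u, rnorm_ge0 v, rnormD u v).
have ruv0 := rnorm_ge0 (u + v).
pose K (w : V) := C * M * (rnorm w / r) ^+ 2.
have K0 (w : V) : 0 <= K w by rewrite /K; nonneg.
pose KK := K (u + v) + K u + K v.
have KK0 : 0 <= KK by rewrite /KK; nonneg.
apply/eqP; rewrite -subr_eq0 -normc_eq0 eq_le normc_ge0 andbT.
apply/ler_addgt0Pl => e e0; rewrite addr0.
have [d d0 Hd] := (continuous_rnormP _ _).1 (gateaux_ball_derive_continuous (v := v) gF xr)
  _ (divr_gt0 e0 (ltr0n _ 2)).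
have d30 : 0 < r / 2 - rnorm (x - x0) by rewrite subr_gt0.
have suv0 : 0 <= rnorm u + rnorm v by rewrite addr_ge0.
have [h [h0 h1 h2 h3 h4]] := exists_small
  (divr_gt01 (divr_gt0 r0 (ltr0n _ 12)) suv0)
  (divr_gt01 d0 ru0) (divr_gt01 d30 ru0) (divr_gt01 (divr_gt0 e0 (ltr0n _ 2)) KK0).
have {}h1 := mul_small h0 suv0 h1; have {}h2 := mul_small h0 ru0 h2.
have {}h3 := mul_small h0 ru0 h3; have {}h4 := mul_small h0 KK0 h4.
have nh : normc h%:C = h by rewrite normc_real gtr0_norm.
have [hu hv] : 0 <= h * rnorm u /\ 0 <= h * rnorm v by rewrite !mulr_ge0 ?(ltW h0).
rewrite mulrDr in h1.
have huv : h * rnorm (u + v) <= h * rnorm u + h * rnorm v by rewrite -mulrDr ler_pM2l.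
have [[b1 b2] b3] : (h * rnorm (u + v) <= r / 12 /\ h * rnorm u <= r / 12) /\
    h * rnorm v <= r / 12.
  by clear - h1 hu hv huv; split; [split|]; lra.
pose y := h%:C *: u + x.
have yx : rnorm (y - x) = h * rnorm u by rewrite /y addrK rnormZ nh.
have yr : rnorm (y - x0) < r / 2.
  by apply: le_lt_trans (rnorm_triangle _ x _) _; rewrite yx; lra.
have := HC _ _ _ _ gF x (u + v) h%:C xr; rewrite nh -/(K _) => /(_ b1) r1.
have := HC _ _ _ _ gF x u h%:C xr; rewrite nh -/(K _) => /(_ b2) r2.
have := HC _ _ _ _ gF y v h%:C yr; rewrite nh -/(K _) => /(_ b3) r3.
have := Hd y; rewrite yx => /(_ h2) r4.
rewrite (_ : h%:C *: (u + v) + x = h%:C *: v + y) in r1; last first.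
  by rewrite scalerDr addrCA addrA.
rewrite -/y in r2.
set A := F _ in r1 r3; set B := F y in r2 r3.
set D1 := 'D_(u + v) F x in r1 *; set D2 := 'D_u F x in r2 *.
set D3 := 'D_v F x in r4 *; set D4 := 'D_v F y in r3 r4.
rewrite -(ler_pM2r h0) -{1}nh -normcM.
rewrite (_ : _ * _ = ((A - B - h%:C * D4) - (A - F x - h%:C * D1)) +
  ((B - F x - h%:C * D2) + h%:C * (D4 - D3))); last by ring.
apply: le_trans (le_normcD _ _) _.
apply: le_trans (lerD (le_normcD _ _) (le_normcD _ _)) _; rewrite normcN [normc (_ * _)]normcM nh.
have hh : K (u + v) * h ^+ 2 + K u * h ^+ 2 + K v * h ^+ 2 <= (e / 2) * h.
  have -> : K (u + v) * h ^+ 2 + K u * h ^+ 2 + K v * h ^+ 2 = (h * KK) * h.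
    by rewrite /KK; ring.
  by rewrite ler_pM2r // ltW.
have r5 : h * normc (D4 - D3) <= (e / 2) * h by rewrite mulrC ler_pM2r // ltW.
have -> : e * h = (e / 2) * h + (e / 2) * h by field.
have sum4 (a b c f k1 k2 k3 q : R) : b <= k1 -> c <= k2 -> a <= k3 -> f <= q ->
    k1 + k2 + k3 <= q -> a + b + (c + f) <= q + q by clear; lra.
exact: sum4 r1 r2 r3 r5 hh.
Qed.

Lemma gateaux_ball_differentiable F x0 r M x : gateaux_ball F x0 r M -> rnorm (x - x0) < r / 2 ->
  differentiable F x.
Proof.
have [C C0 HC] := gateaux_ball_remainder.
move=> gF xr; have M0 := gateaux_ball_ge0 gF; have [r0 H] := gF.
have dx v : derivable F x v by have [|_ dF _] := H x; [lra|exact: dF].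
(* [K1] is the remainder constant. [K2] bounds the differential by a Cauchy estimate: the remainder
   at a step t with t |v| = r / 12 gives t |D_v F x| <= 2 M + C M. *)
pose K1 := C * M / r ^+ 2; pose K2 := (M + M + C * M) * (12 / r).
have K10 : 0 <= K1 by rewrite /K1; nonneg.
have K20 : 0 <= K2 by rewrite /K2; nonneg.
apply: (@differentiable_quadratic _ _ F x (fun v => 'D_v F x) (K1 + K2) (r / 12)).
- move=> a u v; rewrite (gateaux_ball_deriveD _ _ gF xr) derive_homogeneous //.
- by rewrite divr_gt0.
- move=> v; rewrite mulrDl; apply: le_trans (_ : K2 * rnorm v <= _); last first.
    by rewrite lerDr mulr_ge0 ?rnorm_ge0.
  have [->|v0] := eqVneq v 0; first by rewrite derive0 normc0 rnorm0 mulr0.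
  have nv : 0 < rnorm v by rewrite -ltcR -rnormE normr_gt0.
  pose t := r / 12 / rnorm v; have t0 : 0 < t by rewrite !divr_gt0.
  have nt : normc t%:C = t by rewrite normc_real gtr0_norm.
  have tv : t * rnorm v = r / 12 by rewrite /t divfK // gt_eqF.
  have := HC _ _ _ _ gF x v t%:C xr; rewrite nt tv => /(_ (lexx _)) r1.
  have yr : rnorm ((t%:C *: v + x) - x0) < r.
    by rewrite -addrA; apply: le_lt_trans (rnormD _ _) _; rewrite rnormZ nt tv; lra.
  have [_ _ b1] := H _ yr; have [_ _ b2] : [/\ {for x, continuous F}, forall v, derivable F x v & normc (F x) <= M] by apply: H; lra.
  rewrite -(ler_pM2r t0) -{1}nt -normcM.
  set D := 'D_v F x in r1 *; set A := F (_ + _) in r1 b1.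
  rewrite (_ : D * t%:C = (A - F x) - (A - F x - t%:C * D)); last by ring.
  apply: le_trans (le_normcD _ _) _; rewrite normcN.
  have tri : normc (A - F x) <= M + M.
    by apply: le_trans (le_normcD _ _) _; rewrite normcN lerD.
  have -> : K2 * rnorm v * t = M + M + C * M.
    by rewrite -mulrA [rnorm v * t]mulrC tv /K2; field; rewrite gt_eqF.
  apply: lerD => //; apply: le_trans r1 _.
  have -> : C * M * (rnorm v / r) ^+ 2 * t ^+ 2 = C * M * (t * rnorm v / r) ^+ 2 by ring.
  rewrite tv -[leRHS]mulr1 ler_wpM2l ?mulr_ge0 ?(ltW C0) //.
  rewrite (_ : r / 12 / r = 12^-1); last by field; rewrite gt_eqF.
  by rewrite exprn_ile1 ?invr_ge0 // invf_le1 //; lra.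
- move=> v vr; have := HC _ _ _ _ gF x v 1 xr.
  have n1 : normc (1 : R[i]) = 1 by rewrite (normc_real 1) normr1.
  rewrite n1 !mul1r scale1r expr1n mulr1 => /(_ (ltW vr)) /le_trans; apply.
  rewrite mulrDl; have -> : C * M * (rnorm v / r) ^+ 2 = K1 * rnorm v ^+ 2.
    by rewrite /K1; field; rewrite gt_eqF.
  by rewrite lerDl mulr_ge0 ?exprn_ge0 ?rnorm_ge0.
Qed.

End Gateaux.

(** * Holomorphy of directional derivatives *)

Section GateauxDerivative.
Variables (R : realType) (V : normedModType R[i]).
Implicit Types (F : V -> R[i]^o) (x v : V) (r M : R).

(* Along a line the difference quotients of F in the direction a are bounded
   holomorphic functions converging uniformly to 'D_a F; their common Taylor
   remainder bound makes the difference quotients of 'D_a F Cauchy. *)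
Lemma gateaux_ball_derive F x0 r M (a : V) x v : gateaux_ball F x0 r M -> rnorm (x - x0) < r / 4 ->
  derivable ('D_a F : V -> R[i]^o) x v.
Proof.
have [C C0 HC] := gateaux_ball_remainder V; have [C1 C10 HC1] := taylor_first_order R.
move=> gF xr; have M0 := gateaux_ball_ge0 gF; have [r0 H] := gF.
have xr2 : rnorm (x - x0) < r / 2 by lra.
pose G := 'D_a F : V -> R[i]^o.
have cG : {for x, continuous G} by exact: (gateaux_ball_derive_continuous gF xr2).
have [d d0 Hd] := (continuous_rnormP _ _).1 cG _ ltr01.
have [r1 [r10 r1d r1r _ _]] := exists_small d0 (divr_gt0 r0 (ltr0n _ 4)) ltr01 ltr01.
(* Bounds the difference quotients [q] near x: there |G| is at most |G x| + 1, and [q] differs from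
   G by at most 1. *)
pose N := normc (G x) + 2; pose Ka := C * M * (rnorm a / r) ^+ 2.
have N0 : 0 <= N by rewrite /N; nonneg.
have Ka0 : 0 <= Ka by rewrite /Ka; nonneg.
pose rho := r1 / (rnorm v + 1).
have rho0 : 0 < rho by apply: divr_gt01 => //; exact: rnorm_ge0.
pose K1 := C1 * N / rho ^+ 2.
have K10 : 0 <= K1 by rewrite /K1; nonneg.
have inr s : normc s < rho -> rnorm ((s *: v + x) - x) < r1.
  rewrite addrK rnormZ ltr_pdivlMr ?ltr_wpDl ?rnorm_ge0 //; apply: le_lt_trans.
  by rewrite ler_wpM2l ?normc_ge0 // lerDl.
have near2 y : rnorm (y - x) < r1 -> rnorm (y - x0) < r / 2.
  by move=> yx; apply: le_lt_trans (rnorm_triangle _ x _) _; clear - yx r1r xr; lra.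
(* [l] may depend on [h], but [K1] does not; the error [2 * Ka * h] comes from replacing [q] by [G]
   at two points. *)
have key (h : R) : 0 < h -> h * rnorm a <= r / 12 -> h * Ka <= 1 ->
    exists l, forall s, normc s <= rho / 6 ->
    normc (G (s *: v + x) - G x - s * l) <= K1 * normc s ^+ 2 + 2 * Ka * h.
  move=> h0 ha hK; have nh : normc h%:C = h by rewrite normc_real gtr0_norm.
  have hC0 : h%:C != 0 by rewrite -normc_gt0 nh.
  pose q y : R[i]^o := h%:C^-1 *: (F (h%:C *: a + y) - F y).
  have qG y : rnorm (y - x) < r1 -> normc (q y - G y) <= Ka * h.
    move=> yx; have := HC _ _ _ _ gF y a h%:C (near2 _ yx); rewrite nh => /(_ ha) Hr.
    rewrite (_ : q y - G y = h%:C^-1 * (F (h%:C *: a + y) - F y - h%:C * G y)); last first.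
      by rewrite [RHS]mulrBr mulrA mulVf ?mul1r.
    rewrite normcM normcV nh mulrC ler_pdivrMr //; apply: le_trans Hr _.
    by rewrite -[leRHS]mulrA -expr2.
  have qN y : rnorm (y - x) < r1 -> normc (q y) <= N.
    move=> yx; have h1 := qG y yx; have h2 := Hd y (lt_le_trans yx r1d).
    rewrite -[q y](subrK (G y)); apply: le_trans (le_normcD _ _) _.
    have h3 : normc (G y) <= normc (G y - G x) + normc (G x).
      by rewrite -{1}(subrK (G x) (G y)) le_normcD.
    apply: le_trans (lerD (lexx _) h3) _; rewrite /N.
    have -> : normc (G x) + 2 = 1 + (1 + normc (G x)) by ring.
    apply: lerD; first by apply: le_trans h1 _; rewrite mulrC.
    by apply: lerD => //; exact: ltW.
  have db : disc_bounded (fun s : R[i]^o => q (s *: v + x)) rho N.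
    split; first exact: rho0.
    move=> s sr; split; last by apply: (qN (s *: v + x)); exact: inr.
    have xin := near2 _ (inr _ sr).
    have d1 : derivable (fun s : R[i]^o => F (s *: v + x)) s 1.
      by apply/derivable_line; have [|_ dF _] := H (s *: v + x); [lra|exact: dF].
    have d2 : derivable (fun s : R[i]^o => F (s *: v + (h%:C *: a + x))) s 1.
      apply/derivable_line; have [|_ dF _] := H (s *: v + (h%:C *: a + x)); last exact: dF.
      rewrite addrCA -addrA; apply: le_lt_trans (rnormD _ _) _; rewrite rnormZ nh.
      by clear - ha xin r0; lra.
    have d3 := @derivableZ R[i] R[i]^o R[i]^o _ (h%:C^-1) s 1 (derivableB d2 d1).
    rewrite (_ : (fun s : R[i]^o => q (s *: v + x)) = h%:C^-1 \*: ((fun s : R[i]^o => F (s *: v + (h%:C *: a + x))) - (fun s : R[i]^o => F (s *: v + x)))); first exact: d3.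
    by apply/funext => t; rewrite /q addrCA.
  have [l dl] : exists l : R[i]^o, is_derive (0 : R[i]^o) 1 (fun s : R[i]^o => q (s *: v + x)) l.
    have [|dq _] := db.2 0; first by rewrite normc0.
    by eexists; apply/derivableP; exact: dq.
  exists l => s sr; have srho : normc s < rho by clear - sr rho0; lra.
  have := HC1 _ _ _ _ db dl s sr; rewrite scale0r add0r.
  have -> : C1 * N * (normc s / rho) ^+ 2 = K1 * normc s ^+ 2.
    by rewrite /K1; field; rewrite gt_eqF.
  move=> T1; have T2 := qG _ (inr _ srho).
  have T3 : normc (q x - G x) <= Ka * h by apply: qG; rewrite subrr rnorm0.
  have E5 (q1 q0 g1 g0 w : R[i]) :
    g1 - g0 - w = (q1 - q0 - w) + ((q0 - g0) - (q1 - g1)) by ring.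
  rewrite (E5 (q (s *: v + x)) (q x)).
  apply: le_trans (le_normcD _ _) _; apply: lerD => //.
  apply: le_trans (le_normcD _ _) _; rewrite normcN.
  have -> : 2 * Ka * h = Ka * h + Ka * h by ring.
  exact: (lerD T3 T2).
pose Q s := (G (s *: v + x) - G x) / s.
have Qkey (h : R) s l : s != 0 ->
    normc (G (s *: v + x) - G x - s * l) <= K1 * normc s ^+ 2 + 2 * Ka * h ->
    normc (Q s - l) <= K1 * normc s + h * (2 * Ka / normc s).
  move=> s0 Hl; have ns0 : 0 < normc s by rewrite normc_gt0.
  rewrite (_ : Q s - l = (G (s *: v + x) - G x - s * l) / s); last first.
    by rewrite [RHS]mulrBl [s * l]mulrC mulfK.
  rewrite normcM normcV ler_pdivrMr //; apply: le_trans Hl _.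
  rewrite le_eqVlt; apply/orP; left; apply/eqP.
  by field; rewrite gt_eqF.
have [l Hl] : exists l, forall s, s != 0 -> normc s < rho / 6 ->
    normc (Q s - l) <= 2 * K1 * normc s.
  apply: limit_at0; first by rewrite divr_gt0.
  (* For fixed s and t the step [h] is taken so small that its error terms stay below [e]; the
     auxiliary [l] cancels in the difference. *)
  move=> s t s0 t0 sd td; apply/ler_addgt0Pl => e e0.
  pose B := 2 * Ka / normc s + 2 * Ka / normc t.
  have B0 : 0 <= B by rewrite /B; nonneg.
  have [h [h0 h1 h2 h3 _]] := exists_small
    (divr_gt01 (divr_gt0 r0 (ltr0n _ 12)) (rnorm_ge0 a)) (divr_gt01 ltr01 Ka0)
    (divr_gt01 e0 B0) ltr01.
  have {}h1 := mul_small h0 (rnorm_ge0 a) h1; have {}h2 := mul_small h0 Ka0 h2.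
  have {}h3 := mul_small h0 B0 h3.
  have [l Hl] := key h h0 (ltW h1) (ltW h2).
  have Qs := Qkey _ _ _ s0 (Hl s (ltW sd)).
  have Qt := Qkey _ _ _ t0 (Hl t (ltW td)).
  have E6 (q1 q2 w : R[i]) : q1 - q2 = (q1 - w) - (q2 - w) by ring.
  rewrite (E6 _ _ l).
  apply: le_trans (le_normcD _ _) _; rewrite normcN.
  apply: le_trans (lerD Qs Qt) _.
  rewrite /B mulrDr in h3; rewrite mulrDr.
  by move: (h * _) (h * _) (K1 * _) (K1 * _) h3 => ? ? ? ? ?; lra.
suff : is_derive x v G (l : R[i]^o) by case.
apply/is_derive_realP => e e0.
have [d1 [d10 d1r d1e _ _]] := exists_small (divr_gt0 rho0 (ltr0n _ 6))
  (divr_gt01 e0 (mulr_ge0 (ler0n _ 2) K10)) ltr01 ltr01.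
exists d1 => // s sd.
have [->|s0] := eqVneq s 0.
  by rewrite scale0r add0r mul0r subrr subr0 normc0 mulr0.
have ns0 : 0 < normc s by rewrite normc_gt0.
rewrite (_ : _ - _ = (Q s - l) * s); last first.
  by rewrite [RHS]mulrBl /Q divfK // [l * s]mulrC.
rewrite normcM ler_pM2r //; apply: le_trans (Hl s s0 (lt_le_trans sd d1r)) _.
rewrite mulrC; apply/ltW/mul_small => //; first by rewrite mulr_ge0.
exact: le_trans (ltW sd) d1e.
Qed.

Lemma gateaux_holo_derive F x (a : V) : gateaux_holo F x -> gateaux_holo ('D_a F : V -> R[i]^o) x.
Proof.
move=> /gateaux_holo_gateaux_ball[r [M gF]]; have [r0 _] := gF.
apply/nbhs_rnormP; exists (r / 4); first by rewrite divr_gt0.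
move=> y yx; split; last by move=> v; apply: gateaux_ball_derive gF yx.
by apply: (gateaux_ball_derive_continuous gF); lra.
Qed.

Lemma gateaux_holo_differentiable F x : gateaux_holo F x -> \forall y \near x, differentiable F y.
Proof.
move=> /gateaux_holo_gateaux_ball[r [M gF]]; have [r0 _] := gF.
apply/nbhs_rnormP; exists (r / 2); first by rewrite divr_gt0.
by move=> y yx; exact: (gateaux_ball_differentiable gF yx).
Qed.

Lemma differentiable_gateaux_holo F x : (\forall y \near x, differentiable F y) -> gateaux_holo F x.
Proof.
apply: filterS => y dF; split; first exact: differentiable_continuous.
by move=> v; exact: diff_derivable.
Qed.

End GateauxDerivative.

Lemma mx_norm_entry (K : numFieldType) m n (x : 'M[K]_(m, n)) i j :
  `|x i j| <= mx_norm x.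
Proof.
by rewrite mx_normE -[leLHS]nngE num_le; exact: (le_bigmax _ _ (i, j)).
Qed.

(** * Iterated partial derivatives and the identity theorem *)

Section Partials.
Variables (R : realType) (p : nat).
Local Notation V := 'rV[R[i]^o]_p.
Implicit Types (F G : V -> R[i]^o) (x v : V) (A : seq 'I_p).

(** The mean value theorem with an intermediate point is real-valued; applying it to real and
    imaginary parts costs the factor 2. *)
Lemma mean_value (P g : R -> R[i]) (a b M : R) : a < b ->
  (forall t, a <= t <= b -> forall e : R, 0 < e -> exists2 d : R, 0 < d &
    forall h : R, `|h| < d -> normc (P (h + t) - P t - h%:C * g t) <= e * `|h|) ->
  (forall t, a <= t <= b -> normc (g t) <= M) ->
  normc (P b - P a) <= 2 * M * (b - a).
Proof.
move=> ab dP gM.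
have real_case (q : R[i] -> R) : (forall z, `|q z| <= normc z) ->
    (forall z w, q (z - w) = q z - q w) -> (forall (h : R) z, q (h%:C * z) = h * q z) ->
    `|q (P b - P a)| <= M * (b - a).
  move=> qn qB qZ.
  have dq t : a <= t <= b -> is_derive t 1 (fun t => q (P t)) (q (g t)).
    move=> /dP H; apply: is_derive_eps => e /H[d d0 Hd]; exists d => // h /Hd.
    by apply: le_trans; rewrite -qZ -!qB.
  have [||c] := @MVT_segment R (fun t => q (P t)) (fun t => q (g t)) a b (ltW ab).
  - by move=> t; rewrite in_itv /= => /andP[ta tb]; apply: dq; rewrite !ltW.
  - apply: continuous_in_subspaceT => t; rewrite inE /= in_itv /= => /dq[dt _].
    by apply: differentiable_continuous; exact/derivable1_diffP.
  rewrite in_itv /= => /gM gc; rewrite qB => ->.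
  have ba0 : 0 < b - a by rewrite subr_gt0.
  by rewrite normrM (gtr0_norm ba0) ler_pM2r //; exact: le_trans (qn _) gc.
apply: le_trans (normc_le_ReIm _) _.
have -> : 2 * M * (b - a) = M * (b - a) + M * (b - a) by ring.
apply: lerD; apply: real_case.
- exact: normc_Re.
- by move=> [? ?] [? ?].
- by move=> h [z1 z2] /=; rewrite mul0r subr0.
- exact: normc_Im.
- by move=> [? ?] [? ?].
- by move=> h [z1 z2] /=; rewrite mul0r addr0.
Qed.

Lemma gateaux_holo_cpartialA A F x : gateaux_holo F x -> gateaux_holo (cpartialA A F) x.
Proof.
move=> gF; elim: A => [|a A IH]; first exact: gF.
exact: (@gateaux_holo_derive _ _ _ _ 'e_a IH).
Qed.

Lemma derive_sum_partials F x v : differentiable F x ->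
  'D_v F x = \sum_(a < p) v 0 a * cpartial a F x.
Proof.
move=> dF; rewrite deriveE // [in LHS](row_sum_delta v) linear_sum.
by apply: eq_bigr => a _; rewrite linearZ /cpartial deriveE.
Qed.

Lemma rnorm_entry x a : normc (x 0 a) <= rnorm x.
Proof.
rewrite -lecR -rnormE; exact: (@mx_norm_entry R[i] 1 p x 0 a).
Qed.

Lemma cpartialA_near_eq A F G x : (\forall y \near x, F y = G y) ->
  \forall y \near x, cpartialA A F y = cpartialA A G y.
Proof.
elim: A => [//|a A IH] /IH/nbhs_interior; apply: filterS => y FG.
exact: near_eq_derive.
Qed.

Lemma cpartialA_scale A F x (k : R[i]) : gateaux_holo F x ->
  \forall y \near x, cpartialA A (fun z => k *: F z) y = k *: cpartialA A F y.
Proof.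
move=> gF; elim: A => [|a A IH]; first by near=> y.
have gA := gateaux_holo_cpartialA A gF.
near=> y; rewrite /= {1}/cpartial.
rewrite (@near_eq_derive _ _ _ _ (k \*: cpartialA A F)); last first.
  by near: y; exact: nbhs_interior IH.
apply: deriveZ; have [_ ] : {for y, continuous (cpartialA A F)} /\
  forall v, derivable (cpartialA A F) y v by near: y; exact: gA.
exact.
Unshelve. all: by end_near. Qed.

(* Induction on k: the hypothesis passes to all partial derivatives of F, and
   the mean value inequality gains one power of the norm. *)
Lemma flat_partials F : gateaux_holo F 0 -> (forall A, cpartialA A F 0 = 0) ->
  forall k, exists B : R, \forall x \near (0 : V), normc (F x) <= B * rnorm x ^+ k.
Proof.
move=> gF F0 k; elim: k F gF F0 => [|k IH] F gF F0.
  have [r [M [r0 H]]] := gateaux_holo_gateaux_ball gF; exists M.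
  by apply/nbhs_rnormP; exists r => // x /H[_ _]; rewrite expr0 mulr1.
have ex a : exists B : R, \forall x \near (0 : V),
    normc (cpartial a F x) <= B * rnorm x ^+ k.
  apply: IH; first exact: (gateaux_holo_cpartialA [:: a] gF).
  (* [foldr] applies the last index first, so the derivatives of [cpartial a F] are those of F along
     lists ending in [a]. *)
  by move=> A; have := F0 (rcons A a); rewrite /cpartialA foldr_rcons.
have [B HB] := choice ex.
have [d d0 Hd] := (nbhs_rnormP _ _).1 (filter_forall (nbhs_filter _) HB).
have [r r0 Hr] := (nbhs_rnormP _ _).1 (gateaux_holo_differentiable gF).
pose S := \sum_(a < p) `|B a|.
exists (2 * S); apply/nbhs_rnormP; exists (Num.min d r); first by rewrite lt_min d0.
move=> x; rewrite subr0 lt_min => /andP[xd xr].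
have tx t : 0 <= t <= 1 -> rnorm (t%:C *: x) <= rnorm x.
  move=> /andP[t0 t1]; rewrite rnormZ normc_real ger0_norm //.
  by rewrite ler_piMl // rnorm_ge0.
have F00 : F 0 = 0 := F0 [::].
suff : normc (F (1%:C *: x) - F (0%:C *: x)) <= 2 * (S * rnorm x ^+ k.+1) * (1 - 0).
  by rewrite scale1r scale0r F00 !subr0 mulr1 mulrA.
apply: (@mean_value (fun t => F (t%:C *: x)) (fun t => 'D_x F (t%:C *: x)) 0 1 _ ltr01).
  move=> t t01 e e0.
  have dF : differentiable F (t%:C *: x).
    by apply: Hr; rewrite subr0; exact: le_lt_trans (tx _ t01) xr.
  have /derivableP/is_derive_realP/(_ e e0)[c c0 Hc] := diff_derivable (v := x) dF.
  exists c => // h hc; have := Hc h%:C; rewrite normc_real => /(_ hc).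
  by rewrite -scalerDl -rmorphD.
move=> t t01; have txr := tx _ t01.
have dF : differentiable F (t%:C *: x).
  by apply: Hr; rewrite subr0; exact: le_lt_trans txr xr.
have Bt := Hd (t%:C *: x); rewrite subr0 in Bt; have {}Bt := Bt (le_lt_trans txr xd).
(* The entries of x in this sum supply the additional power of the norm. *)
rewrite derive_sum_partials // /S mulr_suml.
elim/big_ind2 : _ => [|z1 y1 z2 y2 h1 h2|a _]; first by rewrite normc0.
  by apply: le_trans (le_normcD _ _) _; exact: lerD.
rewrite normcM exprS mulrCA; apply: ler_pM; rewrite ?normc_ge0 ?rnorm_entry //.
apply: le_trans (Bt a) _; apply: le_trans (_ : `|B a| * rnorm (t%:C *: x) ^+ k <= _).
  by rewrite ler_wpM2r ?exprn_ge0 ?rnorm_ge0 // ler_norm.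
by rewrite ler_wpM2l // lerXn2r ?nnegrE ?rnorm_ge0.
Qed.

(** F is flat at 0 along every complex line through 0, hence zero on a disc of each. The point x is
    reached at t = 1 on a line of radius [r / rnorm x], and [rnorm x < r / 6] puts 1 within a sixth
    of that radius. *)
Lemma identity_theorem F : gateaux_holo F 0 -> (forall A, cpartialA A F 0 = 0) ->
  \forall x \near (0 : V), F x = 0.
Proof.
move=> gF F0; have flat := flat_partials gF F0.
have [r [M [r0 H]]] := gateaux_holo_gateaux_ball gF.
apply/nbhs_rnormP; exists (r / 6); first by rewrite divr_gt0.
move=> x; rewrite subr0 => xr.
have [->|x0] := eqVneq x 0; first exact: (F0 [::]).
have nx : 0 < rnorm x by rewrite -ltcR -rnormE normr_gt0.
pose rho := r / rnorm x.
have db : disc_bounded (fun t : R[i]^o => F (t *: x)) rho M.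
  split; first by rewrite divr_gt0.
  move=> t; rewrite ltr_pdivlMr // => tr.
  have [|_ dF bF] := H (t *: x); first by rewrite subr0 rnormZ.
  split => //; have := (derivable_line F 0 x t).1; rewrite addr0 => /(_ (dF x)).
  by rewrite (_ : (fun s : R[i]^o => _) = fun s : R[i]^o => F (s *: x)) //;
    apply/funext => s; rewrite addr0.
have := @flat_zero _ _ _ _ db _ 1; rewrite scale1r; apply.
  move=> k; have [B /nbhs_rnormP[d d0 Hd]] := flat k.
  exists (B * rnorm x ^+ k), (d / rnorm x); split; first by rewrite divr_gt0.
  move=> t; rewrite ltr_pdivlMr // => td.
  have := Hd (t *: x); rewrite subr0 rnormZ => /(_ td) /le_trans; apply.
  by rewrite exprMn mulrAC -mulrA.
rewrite (normc_real 1) normr1 /rho mulrAC ler_pdivlMr // mul1r.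
exact: ltW.
Qed.

End Partials.

(** * Holomorphic n-th roots *)

Section Roots.
Variable R : realType.
Implicit Types (a b z w : R[i]).

Lemma ctsX (phi : R[i] -> R[i]) z n : cts phi z -> cts (fun w => phi w ^+ n) z.
Proof.
move=> c; elim: n => [|n IH].
  by rewrite (_ : (fun _ => _) = fun=> 1); [exact: cts_cst|apply/funext => w; rewrite expr0].
rewrite (_ : (fun _ => _) = fun w => phi w * phi w ^+ n); first exact: ctsM.
by apply/funext => w; rewrite exprS.
Qed.

Lemma cts_id z : cts id z.
Proof. by move=> e e0; exists e. Qed.

Lemma ctsV (phi : R[i] -> R[i]) z : cts phi z -> phi z != 0 ->
  cts (fun w => (phi w)^-1) z.
Proof.
move=> /ctsP c n0; apply/ctsP.
exact: (@continuousV R[i] R[i]^o (phi : R[i]^o -> R[i]^o) z n0 c).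
Qed.

Lemma cts_punctured_eq (phi psi : R[i] -> R[i]) (d : R) : 0 < d ->
  cts phi 0 -> cts psi 0 ->
  (forall t, t != 0 -> normc t < d -> phi t = psi t) -> phi 0 = psi 0.
Proof.
move=> d0 c1 c2 E; apply/eqP; rewrite -subr_eq0 -normc_eq0 eq_le normc_ge0 andbT.
apply/ler_addgt0Pl => e e0; rewrite addr0.
have [r r0 Hr] := c1 _ (divr_gt0 e0 (ltr0n _ 2)).
have [s s0 Hs] := c2 _ (divr_gt0 e0 (ltr0n _ 2)).
have [h [h0 h1 h2 h3 _]] := exists_small (divr_gt0 d0 (ltr0n _ 2))
  (divr_gt0 r0 (ltr0n _ 2)) (divr_gt0 s0 (ltr0n _ 2)) ltr01.
have nh : normc h%:C = h by rewrite normc_real gtr0_norm.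
have hn0 : h%:C != 0 by rewrite -normc_gt0 nh.
have := Hr h%:C; rewrite subr0 nh => /(_ ltac:(lra)) H1.
have := Hs h%:C; rewrite subr0 nh => /(_ ltac:(lra)) H2.
rewrite E ?nh // in H1; last by clear - h1 d0; lra.
have E6 (p q w : R[i]) : p - q = (w - q) - (w - p) by ring.
rewrite (E6 _ _ (psi h%:C)); apply: le_trans (le_normcD _ _) _; rewrite normcN.
have -> : e = e / 2 + e / 2 by field.
exact: (lerD (ltW H2) (ltW H1)).
Qed.

Lemma prod_gt (r : seq R[i]) (f : R[i] -> R) (y : R) : 0 <= y -> r != [::] ->
  (forall z, z \in r -> y < f z) -> y ^+ size r < \prod_(z <- r) f z.
Proof.
move=> y0; elim: r => [//|z [|z' r] IH] _ H.
  by rewrite big_seq1 expr1; apply: H; rewrite mem_seq1.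
rewrite big_cons exprS; apply: ltr_pM => //; first by rewrite exprn_ge0.
  by apply: H; rewrite mem_head.
by apply: IH => // w wr; apply: H; rewrite inE wr orbT.
Qed.

(* Evaluating X^n - w = prod (X - z) at 1 shows that some n-th root z of w
   is as close to 1 as the geometric mean allows. *)
Lemma nth_root_near1 n w : (0 < n)%N ->
  exists z, z ^+ n = w /\ normc (1 - z) ^+ n <= normc (1 - w).
Proof.
move=> n0; pose P : {poly R[i]} := 'X^n - w%:P.
have Pm : P \is monic by exact: monicXnsubC.
have [r Pr] := closed_field_poly_normal P.
rewrite (monicP Pm) scale1r in Pr.
have sr : size r = n.
  by apply: succn_inj; rewrite -(size_prod_XsubC r id) -Pr size_XnsubC.
have rn0 : r != [::] by rewrite -size_eq0 sr -lt0n.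
have P1 : 1 - w = \prod_(z <- r) (1 - z).
  have := congr1 (fun q : {poly R[i]} => q.[1]) Pr; rewrite /P.
  rewrite hornerD hornerXn hornerN hornerC expr1n horner_prod => ->.
  by apply: eq_bigr => z _; rewrite hornerXsubC.
have [[z zr zw]|H] := pselect (exists2 z, z \in r & normc (1 - z) ^+ n <= normc (1 - w)).
  exists z; split => //.
  have : root P z by rewrite Pr root_prod_XsubC.
  by rewrite /root /P hornerD hornerXn hornerN hornerC subr_eq0 => /eqP.
exfalso.
have : normc (1 - w) ^+ size r < \prod_(z <- r) normc (1 - z) ^+ n.
  apply: prod_gt => //; first exact: normc_ge0.
  by move=> z zr; rewrite ltNge; apply/negP => zw; apply: H; exists z.
rewrite sr prodrXl (_ : \prod_(z <- r) normc (1 - z) = normc (1 - w)) ?ltxx //.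
rewrite P1; elim: (r) => [|z s IH]; first by rewrite !big_nil (normc_real 1) normr1.
by rewrite !big_cons normcM IH.
Qed.

(** Write a^n - b^n = (a - b) S. Each of the n terms of S is within 1/4 * 1/4 + 1/4 + 1/4 = 9/16 of
    1, so |S| >= 7 n / 16 >= 7/16. This gives both the continuity of n-th roots near 1 and the local
    uniqueness of branches. *)
Lemma pow_expanding n : (0 < n)%N -> exists c d : R, [/\ 0 < c, 0 < d &
  forall a b, normc (a - 1) < d -> normc (b - 1) < d ->
    c * normc (a - b) <= normc (a ^+ n - b ^+ n)].
Proof.
move=> n0.
have near_i (i : 'I_n) :
    \forall a \near (1 : R[i]^o), normc ((a : R[i]) ^+ i - 1) < 1 / 4.
  apply/nbhs_realP.
  have e0 : 0 < 1 / 4 :> R by rewrite divr_gt0.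
  have [d d0 Hd] := ctsX i (@cts_id 1) e0; exists d => // y yd.
  by have := Hd y; rewrite expr1n; apply; rewrite -ltcR; exact: yd.
have /nbhs_realP[d d0 Hd] := filter_forall (nbhs_filter _) near_i.
exists (7 / 16), d; split; [by rewrite divr_gt0|exact: d0|].
have {}Hd a : normc (a - 1) < d -> forall i : 'I_n, normc (a ^+ i - 1) < 1 / 4.
  by rewrite -ltcR => ad; exact: Hd.
move=> a b /Hd Ha /Hd Hb; rewrite subrXX normcM mulrC ler_wpM2l ?normc_ge0 //.
set S := \sum_(i < n) _.
have term (i : 'I_n) : normc (a ^+ (n.-1 - i) * b ^+ i - 1) <= 9 / 16.
  have ni : (n.-1 - i < n)%N by rewrite (leq_ltn_trans (leq_subr _ _)) // prednK.
  have h1 := Ha (Ordinal ni); have h2 := Hb i; rewrite /= in h1.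
  set x := a ^+ _ in h1 *; set y := b ^+ _ in h2 *.
  have -> : x * y - 1 = (x - 1) * (y - 1) + ((x - 1) + (y - 1)) by ring.
  apply: le_trans (le_normcD _ _) _; rewrite normcM.
  have h3 := le_normcD (x - 1) (y - 1).
  have h4 : normc (x - 1) * normc (y - 1) <= 1 / 4 * (1 / 4).
    by rewrite ler_pM ?normc_ge0 // ltW.
  by clear - h1 h2 h3 h4; lra.
have Sn : normc (S - n%:R) <= n%:R * (9 / 16).
  rewrite /S -[X in _ - X%:R](card_ord n) -sumr_const -sumrB.
  have -> : n%:R * (9 / 16) = \sum_(i < n) (9 / 16 : R) by rewrite sumr_const card_ord mulr_natl.
  elim/big_ind2 : _ => [|z1 y1 z2 y2 k1 k2|i _]; [by rewrite normc0| |exact: term].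
  by apply: le_trans (le_normcD _ _) _; exact: lerD.
have nN : normc (n%:R : R[i]) = n%:R.
  by rewrite -[n%:R](rmorph_nat (real_complex R)) normc_real normr_nat.
have : n%:R <= normc S + normc (S - n%:R).
  rewrite -nN [normc (S - _)]normcB -{1}(subrKC S n%:R); exact: le_normcD.
have n1 : 1 <= n%:R :> R by rewrite ler1n.
by clear - Sn n1; lra.
Qed.

Lemma cdiff_pow n b : cdiff (fun a => a ^+ n) b (n%:R * b ^+ n.-1).
Proof.
apply/cdiffP.
have := is_deriveX n (is_derive_id (b : R[i]^o) 1).
by rewrite exprfctE /GRing.scale /= mulr1.
Qed.

(** [rho] is a pointwise choice among the roots given by [nth_root_near1], which keeps it near 1;
    [pow_expanding] makes it Lipschitz there, and its derivative is the inverse of that of the power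
    map. *)
Lemma nth_root_branch n : (0 < n)%N -> exists (rho : R[i] -> R[i]) (d : R),
  [/\ 0 < d, forall w, rho w ^+ n = w &
      forall w, normc (w - 1) < d -> exists l, cdiff rho w l].
Proof.
move=> n0; have [rho Hrho] := choice (fun w => nth_root_near1 w n0).
have [c [d [c0 d0 Hcd]]] := pow_expanding n0.
(* The radius [d ^+ n] brings [rho w] within [d] of 1; the bound 1 excludes w = 0. *)
have d2 : 0 < Num.min (d ^+ n) 1 by rewrite lt_min exprn_gt0 //=.
exists rho, (Num.min (d ^+ n) 1); split => //; first by move=> w; case: (Hrho w).
have rho1 w : normc (w - 1) < Num.min (d ^+ n) 1 -> normc (rho w - 1) < d.
  rewrite lt_min => /andP[wd _]; have [_] := Hrho w.
  rewrite [normc (1 - w)]normcB [normc (1 - rho w)]normcB => h.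
  by rewrite -(ltr_pXn2r n0) ?nnegrE ?normc_ge0 ?(ltW d0) //; exact: le_lt_trans h wd.
move=> w wd; have rw := rho1 w wd.
have w0 : w != 0.
  apply: contraTneq wd => ->; rewrite sub0r normcN (normc_real 1) normr1.
  by rewrite -leNgt ge_min lexx orbT.
have b0 : rho w != 0.
  by apply: contra_neq w0 => E; case: (Hrho w) => <- _; rewrite E expr0n gtn_eqF.
pose l := n%:R * rho w ^+ n.-1 : R[i].
have l0 : l != 0 by rewrite mulf_neq0 ?expf_neq0 // pnatr_eq0 -lt0n.
have nl : 0 < normc l by rewrite normc_gt0.
have lip w' : normc (w' - w) < Num.min (d ^+ n) 1 - normc (w - 1) ->
    c * normc (rho w' - rho w) <= normc (w' - w).
  move=> h; have [E1 _] := Hrho w; have [E2 _] := Hrho w'.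
  rewrite -[in leRHS]E1 -[in leRHS]E2; apply: Hcd => //; apply: rho1.
  have -> : w' - 1 = (w' - w) + (w - 1) by rewrite addrA subrK.
  by apply: le_lt_trans (le_normcD _ _) _; rewrite -ltrBrDr.
exists l^-1 => e e0.
have e1 : 0 < e * c * normc l by rewrite !mulr_gt0.
have [r r0 Hr] := cdiff_pow n (rho w) e1.
have rc : 0 < r * c by rewrite mulr_gt0.
have d3 : 0 < Num.min (d ^+ n) 1 - normc (w - 1) by rewrite subr_gt0.
exists (Num.min (r * c) (Num.min (d ^+ n) 1 - normc (w - 1))); first by rewrite lt_min rc.
move=> w'; rewrite lt_min => /andP[h1 /lip h2].
have h3 : normc (rho w' - rho w) < r.
  by rewrite -(ltr_pM2r c0) mulrC; exact: le_lt_trans h2 h1.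
have := Hr _ h3; have [-> _] := Hrho w'; have [-> _] := Hrho w; rewrite -/l => h4.
have -> : rho w' - rho w - l^-1 * (w' - w) = - (l^-1 * (w' - w - l * (rho w' - rho w))).
  have E7 (u1 u2 k X : R[i]) : k != 0 ->
      u1 - u2 - k^-1 * X = - (k^-1 * (X - k * (u1 - u2))) by move=> k0; field.
  exact: E7.
rewrite normcN normcM normcV mulrC ler_pdivrMr //.
apply: le_trans h4 _.
have -> : e * c * normc l * normc (rho w' - rho w) =
  e * normc l * (c * normc (rho w' - rho w)) by ring.
have -> : e * normc (w' - w) * normc l = e * normc l * normc (w' - w) by ring.
by rewrite ler_wpM2l // mulr_ge0 // ltW.
Qed.

Lemma differentiable_root (V : normedModType R[i]) (g : V -> R[i]^o) (x : V) n :
  (0 < n)%N -> (\forall y \near x, differentiable g y) -> g x != 0 ->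
  exists G : V -> R[i]^o, \forall y \near x, differentiable G y /\ G y ^+ n = g y.
Proof.
move=> n0 dg gx0; have [rho [d [d0 rhoE drho]]] := nth_root_branch n0.
(* Dividing by [g x] moves the values near 1, where [rho] is differentiable; [rho (g x)] is a
   constant root. *)
exists (fun y => rho (g x) *: (rho ((g x)^-1 *: g y) : R[i]^o)).
have cg : {for x, continuous g}.
  by apply: differentiable_continuous; exact: nbhs_singleton dg.
have gd : 0 < d * normc (g x) by rewrite mulr_gt0 // normc_gt0.
have [r r0 Hr] := (continuous_rnormP _ _).1 cg _ gd.
have near1 : \forall y \near x, normc ((g x)^-1 * g y - 1) < d.
  apply/nbhs_rnormP; exists r => // y /Hr h.
  rewrite (_ : _ - 1 = (g x)^-1 * (g y - g x)); last by rewrite [RHS]mulrBr mulVf.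
  by rewrite normcM normcV mulrC ltr_pdivrMr // normc_gt0.
near=> y; split; last first.
  rewrite [_ *: _]/(_ * _) exprMn !rhoE /GRing.scale /= mulrA mulfV ?mul1r //.
have dgy : differentiable g y by near: y.
have [l dl] : exists l, cdiff rho ((g x)^-1 * g y) l by apply: drho; near: y.
have dr : differentiable (rho : R[i]^o -> R[i]^o) ((g x)^-1 *: g y).
  by apply/derivable1_diffP/cdiffableP; exists l.
have dsc : differentiable ((g x)^-1 \*: g) y by exact: differentiableZ.
have dcomp := differentiable_comp dsc dr.
exact: (differentiableZ (rho (g x)) dcomp).
Unshelve. all: by end_near. Qed.

End Roots.

(** * Lifts *)

Section Lines.
Variables (R : realType) (V : normedModType R[i]).
Implicit Types (F : V -> R[i]^o) (x v : V) (r M : R).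

Lemma gateaux_holo_line F x v : gateaux_holo F x ->
  exists rho M, disc_bounded (fun t : R[i]^o => F (t *: v + x)) rho M.
Proof.
move=> /gateaux_holo_gateaux_ball[r [M [r0 H]]].
exists (r / (rnorm v + 1)), M; split.
  by apply: divr_gt01 => //; exact: rnorm_ge0.
move=> t; rewrite ltr_pdivlMr ?ltr_wpDl ?rnorm_ge0 // => tr.
have [|_ dF bF] := H (t *: v + x).
  rewrite addrK rnormZ; apply: le_lt_trans tr.
  by rewrite ler_wpM2l ?normc_ge0 // lerDl.
by split => //; exact/derivable_line.
Qed.

Lemma near_line (P : set V) x v : (\forall y \near x, P y) ->
  exists2 d : R, 0 < d & forall t : R[i], normc t < d -> P (t *: v + x).
Proof.
move=> /nbhs_rnormP[r r0 Hr]; exists (r / (rnorm v + 1)).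
  by apply: divr_gt01 => //; exact: rnorm_ge0.
move=> t; rewrite ltr_pdivlMr ?ltr_wpDl ?rnorm_ge0 // => tr; apply: Hr.
rewrite addrK rnormZ; apply: le_lt_trans tr.
by rewrite ler_wpM2l ?normc_ge0 // lerDl.
Qed.

(** [u] is the quotient by t^k, completed at 0 by its limit. Its continuity and nonvanishing at 0
    are what the comparison of orders uses. *)
Lemma order_factor F x v : gateaux_holo F x ->
  (exists2 d : R, 0 < d & forall t, normc t < d -> F (t *: v + x) = 0) \/
  exists k (u : R[i] -> R[i]), [/\ u 0 != 0, cts u 0 &
    forall t, t != 0 -> F (t *: v + x) = u t * t ^+ k].
Proof.
move=> /(gateaux_holo_line v)[rho [M db]]; have [rho0 _] := db.
have [H|[k [c [c0 Hc]]]] := order_dichotomy db; [left|right].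
  by exists (rho / 6); [rewrite divr_gt0|move=> t /ltW; exact: H].
exists k, (fun t => if t == 0 then c else F (t *: v + x) / t ^+ k).
rewrite eqxx; split => //.
  move=> e e0; have [d d0 Hd] := Hc e e0; exists d => // t; rewrite subr0 eqxx => td.
  have [t0|t0] := eqVneq t 0; first by rewrite subrr normc0.
  exact: Hd.
by move=> t t0; rewrite (negbTE t0) divfK // expf_neq0.
Qed.

Lemma differentiable_exp F m x : differentiable F x ->
  differentiable (fun y => F y ^+ m : R[i]^o) x.
Proof.
move=> dF; elim: m => [|m IH].
  rewrite (_ : (fun _ => _) = cst (1 : R[i]^o)); first exact: differentiable_cst.
  by apply/funext => y; rewrite expr0.
rewrite (_ : (fun _ => _) = F * (fun y => F y ^+ m : R[i]^o)).
  exact: differentiableM.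
by apply/funext => y; rewrite exprS.
Qed.

End Lines.

(** * Local branches of the n-th root and the two implications *)

Section Branches.
Variables (R : realType) (p n : nat).
Hypothesis n_gt1 : (1 < n)%N.
Local Notation V := 'rV[R[i]^o]_p.
Implicit Types (f F G H : V -> R[i]^o) (x y v : V).

Let n0 : (0 < n)%N. Proof. exact: ltnW. Qed.
Let n10 : (0 < n.-1)%N. Proof. by rewrite -subn1 subn_gt0. Qed.

Lemma branch_gateaux_holo f F x : local_branch n f F x -> gateaux_holo F x.
Proof. by move=> H; apply: differentiable_gateaux_holo; apply: filterS H => y []. Qed.

(** The quotient G / F, normalised to 1 at x, is continuous and takes n-th roots of unity as values
    near x; [pow_expanding] isolates 1 among these roots. *)
Lemma branch_unique f F G x : f x != 0 ->
  local_branch n f F x -> local_branch n f G x ->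
  exists2 z : R[i], z ^+ n = 1 & \forall y \near x, G y = z *: F y.
Proof.
move=> fx0 bF bG.
have [dF Fx] := nbhs_singleton bF; have [dG Gx] := nbhs_singleton bG.
have F0 : F x != 0 by apply: contra_neq fx0 => E; rewrite -Fx E expr0n gtn_eqF.
have G0 : G x != 0 by apply: contra_neq fx0 => E; rewrite -Gx E expr0n gtn_eqF.
have [c [d [c0 d0 Hcd]]] := pow_expanding R n0.
pose q y : R[i] := (F x / G x) * (G y / F y).
have dq : differentiable (fun y => G y * (F y)^-1) x.
  by apply: differentiableM => //; exact: differentiableV.
have cq := (continuous_rnormP _ _).1 (differentiable_continuous dq).
have gd : 0 < d / normc (F x / G x).
  by rewrite divr_gt0 // normc_gt0 mulf_neq0 // invr_eq0.
have [r r0 Hr] := cq _ gd.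
have q1 : \forall y \near x, normc (q y - 1) < d.
  apply/nbhs_rnormP; exists r => // y /Hr h.
  have nz : 0 < normc (F x / G x) by rewrite normc_gt0 mulf_neq0 // invr_eq0.
  rewrite (_ : q y - 1 = (F x / G x) * (G y / F y - G x / F x)); last first.
    by rewrite /q mulrBr; congr (_ - _); field; rewrite F0 G0.
  by rewrite normcM mulrC -ltr_pdivlMr.
have cf0 : \forall y \near x, F y != 0.
  have [s s0 Hs] := (continuous_rnormP _ _).1 (differentiable_continuous dF)
    (normc (F x)) ltac:(by rewrite normc_gt0).
  apply/nbhs_rnormP; exists s => // y /Hs; apply: contraTneq => ->.
  by rewrite sub0r normcN ltxx.
exists (G x / F x); first by rewrite exprMn exprVn Fx Gx mulfV.
near=> y.
have Fy0 : F y != 0 by near: y.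
have Fy : F y ^+ n = f y by have [] : differentiable F y /\ F y ^+ n = f y by near: y.
have Gy : G y ^+ n = f y by have [] : differentiable G y /\ G y ^+ n = f y by near: y.
have qy1 : normc (q y - 1) < d by near: y.
have fy0 : f y != 0 by rewrite -Fy expf_neq0.
have qn : q y ^+ n = 1.
  by rewrite /q !exprMn !exprVn Fx Gx Fy Gy !mulfV // mulr1.
have := Hcd (q y) 1 qy1 ltac:(by rewrite subrr normc0).
rewrite qn expr1n subrr normc0 pmulr_rle0 // => h.
have {h} qy : q y = 1.
  by apply/eqP; rewrite -subr_eq0 -normc_eq0 eq_le h normc_ge0.
rewrite /GRing.scale /= -[LHS]mulr1 -[G y in LHS](divfK Fy0) mulr1.
congr (_ * _); rewrite -[RHS]mulr1 -qy /q; field.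
by rewrite Fy0 F0 G0.
Unshelve. all: by end_near. Qed.

(** Any other branch is z F with z^n = 1, and its derivative is z d_A F; the two expressions change
    by the factors z^(n-1) z = 1 and z^n = 1. *)
Lemma lift_extensions f F (A : seq 'I_p) :
  (\forall x \near (0 : V), differentiable F x /\ F x ^+ n = f x) ->
  holo_ext_at0 n f (f1A n A) (fun x => F x ^+ n.-1 * cpartialA A F x) /\
  holo_ext_at0 n f (fnA n A) (fun x => cpartialA A F x ^+ n).
Proof.
move=> bF; have gF : gateaux_holo F 0 := branch_gateaux_holo bF.
have dA := gateaux_holo_differentiable (gateaux_holo_cpartialA A gF).
have key : \forall x \near (0 : V), [/\ differentiable F x,
    differentiable (cpartialA A F) x & f x != 0 -> forall G, local_branch n f G x ->
      exists z : R[i], [/\ z ^+ n = 1, G x = z * F x &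
        cpartialA A G x = z * cpartialA A F x]].
  near=> x; have bx : local_branch n f F x by near: x; exact: nbhs_interior bF.
  split; [by have [] := nbhs_singleton bx|by near: x|].
  move=> fx0 G bG; have [z zn GF] := branch_unique fx0 bx bG.
  exists z; split => //; first exact: (nbhs_singleton GF).
  rewrite (nbhs_singleton (cpartialA_near_eq A GF)).
  exact: (nbhs_singleton (cpartialA_scale A z (branch_gateaux_holo bx))).
split; apply: filterS key => x [dFx dAx Hx]; split.
- have dX : differentiable (fun y => F y ^+ n.-1) x by exact: differentiable_exp.
  exact: differentiableM.
- move=> fx0 G /(Hx fx0)[z [zn GE AE]]; rewrite /f1A GE AE exprMn.
  have {1}-> : F x ^+ n.-1 * cpartialA A F x =
    z ^+ n.-1 * z * (F x ^+ n.-1 * cpartialA A F x).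
    by rewrite -exprSr prednK // zn mul1r.
  ring.
- exact: differentiable_exp.
- by move=> fx0 G /(Hx fx0)[z [zn GE AE]]; rewrite /fnA AE exprMn zn mul1r.
Unshelve. all: by end_near. Qed.

(* Comparing leading terms of f = t^k u and H = t^m w along a line gives
   n m = (n - 1) k, so f / H = t^(k - m) u / w with k - m > 0. *)
Lemma quotient_derivable f H x v : gateaux_holo f x -> gateaux_holo H x -> f x = 0 ->
  (\forall y \near x, f y != 0 -> H y ^+ n = f y ^+ n.-1) ->
  derivable (fun y => f y / H y) x v.
Proof.
move=> gf gH fx0 HE; have [d d0 Hd] := near_line v HE.
suff [d1 [l [u [d10 l0 cu uE]]]] : exists (d1 : R) l (u : R[i] -> R[i]),
    [/\ 0 < d1, (0 < l)%N, cts u 0 &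
     forall t, t != 0 -> normc t < d1 -> f (t *: v + x) / H (t *: v + x) = u t * t ^+ l].
  (* The derivative is [u 0] if l = 1 and 0 if l > 1; since [0 ^+ 0] is 1, one expression covers
     both. *)
  suff : is_derive x v (fun y => f y / H y) ((u 0 * 0 ^+ l.-1 : R[i]) : R[i]^o) by case.
  have cU : cts (fun t => u t * t ^+ l.-1) 0 by apply: ctsM => //; exact/ctsX/cts_id.
  apply/is_derive_realP => e e0; have [r r0 Hr] := cU e e0.
  exists (Num.min d1 r); first by rewrite lt_min d10.
  move=> h; rewrite lt_min => /andP[hd hr]; rewrite fx0 mul0r subr0.
  have [->|h0] := eqVneq h 0.
    by rewrite scale0r add0r fx0 !mul0r subr0 normc0 mulr0.
  rewrite uE // -(prednK l0) exprS /= (_ : _ - _ = h * (u h * h ^+ l.-1 - u 0 * 0 ^+ l.-1)); last by ring.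
  rewrite normcM mulrC ler_wpM2r ?normc_ge0 //; apply: ltW; apply: Hr.
  by rewrite subr0.
have [[d1 d10 Hf]|[k [u [u0 cu uE]]]] := order_factor v gf.
  (* If [f] vanishes along the line, so does the quotient, whatever the values of [H]. *)
  exists d1, 1%N, (fun=> 0); split => //; first exact: cts_cst.
  by move=> t _ td; rewrite Hf // !mul0r.
have [s s0 us] : exists2 s : R, 0 < s & forall t, normc t < s -> u t != 0.
  have [s s0 Hs] := cu (normc (u 0)) ltac:(by rewrite normc_gt0).
  exists s => // t ts; have := Hs t; rewrite subr0 => /(_ ts).
  by apply: contraTneq => ->; rewrite sub0r normcN ltxx.
have rel t : t != 0 -> normc t < Num.min d s ->
    H (t *: v + x) ^+ n = (u t * t ^+ k) ^+ n.-1.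
  move=> t0; rewrite lt_min => /andP[/Hd Ht /us ut].
  by rewrite -uE //; apply: Ht; rewrite uE // mulf_neq0 // expf_neq0.
have ds : 0 < Num.min d s by rewrite lt_min d0.
have [[d2 d20 H0]|[m [w [w0 cw wE]]]] := order_factor v gH.
  (* [H] cannot vanish along the line, because H^n = f^(n-1) is nonzero at small t != 0. *)
  exfalso; have [h [h0 h1 h2 _ _]] := exists_small
    (divr_gt0 ds (ltr0n _ 2)) (divr_gt0 d20 (ltr0n _ 2)) ltr01 ltr01.
  have nh : normc h%:C = h by rewrite normc_real gtr0_norm.
  have hn0 : h%:C != 0 by rewrite -normc_gt0 nh.
  have hs : normc h%:C < Num.min d s.
    by rewrite nh; apply: le_lt_trans h1 _; rewrite ltr_pdivrMr // mulr_natr mulr2n ltrDl.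
  have hd2 : normc h%:C < d2 by rewrite nh; clear - h2 d20; lra.
  have := rel _ hn0 hs; rewrite (H0 _ hd2) expr0n gtn_eqF //= => /esym/eqP.
  rewrite expf_eq0 n10 /= mulf_eq0 expf_eq0 (negbTE hn0) andbF orbF.
  by apply/negP/us; move: hs; rewrite lt_min => /andP[].
have cX j : cts (fun t : R[i] => t ^+ j) 0 by exact/ctsX/cts_id.
have nm : (n * m = n.-1 * k)%N.
  have rel2 t : t != 0 -> normc t < Num.min d s ->
      w t ^+ n * t ^+ (n * m) = u t ^+ n.-1 * t ^+ (n.-1 * k).
    move=> t0 /(rel t t0); rewrite wE // !exprMn -!exprM.
    by rewrite [(m * n)%N]mulnC [(k * _)%N]mulnC.
  (* If the exponents differed, cancelling the smaller power of t and letting t tend to 0 would give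
     [w 0 = 0] or [u 0 = 0]. *)
  case: (ltngtP (n * m)%N (n.-1 * k)%N) => // lt1; exfalso.
    have := @cts_punctured_eq _ (fun t => w t ^+ n)
      (fun t => u t ^+ n.-1 * t ^+ (n.-1 * k - n * m)) _ ds (ctsX _ cw)
      (ctsM (ctsX _ cu) (cX _)).
    rewrite expr0n subn_eq0 leqNgt lt1 mulr0 => E.
    move: w0; rewrite -[_ == 0]andTb -n0 -expf_eq0 E ?eqxx // => t t0 ts.
    apply: (mulIf (expf_neq0 (n * m) t0)); rewrite rel2 // -mulrA -exprD.
    by rewrite subnK // ltnW.
  have := @cts_punctured_eq _ (fun t => u t ^+ n.-1)
    (fun t => w t ^+ n * t ^+ (n * m - n.-1 * k)) _ ds (ctsX _ cu)
    (ctsM (ctsX _ cw) (cX _)).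
  rewrite expr0n subn_eq0 leqNgt lt1 mulr0 => E.
  move: u0; rewrite -[_ == 0]andTb -n10 -expf_eq0 E ?eqxx // => t t0 ts.
  apply: (mulIf (expf_neq0 (n.-1 * k) t0)); rewrite -rel2 // -mulrA -exprD.
  by rewrite subnK // ltnW.
(* This is where [f x = 0] enters: k > 0 turns n m = (n-1) k into n m < n k. *)
have k0 : (0 < k)%N.
  rewrite lt0n; apply/eqP => k0.
  have cf : cts (fun t => f (t *: v + x)) 0.
    apply/ctsP; have [rho [M [r0 db]]] := gateaux_holo_line v gf.
    apply: differentiable_continuous; apply/derivable1_diffP.
    by have [] := db 0; rewrite ?normc0.
  have := @cts_punctured_eq _ _ _ _ ds cf cu; rewrite scale0r add0r fx0 => E.
  by move: u0; rewrite -E ?eqxx // => t t0 _; rewrite uE // k0 mulr1.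
have mk : (m < k)%N.
  rewrite -(ltn_pmul2l n0) nm ltn_pmul2r // prednK //.
have [s1 s10 ws] : exists2 s : R, 0 < s & forall t, normc t < s -> w t != 0.
  have [s1 s10 Hs] := cw (normc (w 0)) ltac:(by rewrite normc_gt0).
  exists s1 => // t ts; have := Hs t; rewrite subr0 => /(_ ts).
  by apply: contraTneq => ->; rewrite sub0r normcN ltxx.
exists s1, (k - m)%N, (fun t => u t * (w t)^-1); split => //.
- by rewrite subn_gt0.
- by apply: ctsM => //; exact: ctsV.
- move=> t t0 ts; rewrite uE // wE //.
  have tm : t ^+ m != 0 by rewrite expf_neq0.
  rewrite -{1}(subnK (ltnW mk)) exprD; field.
  by rewrite tm ws.
Qed.

Lemma lift_of_extensions f (A : seq 'I_p) g1 gn :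
  (\forall x \near (0 : V), differentiable f x) ->
  holo_ext_at0 n f (f1A n A) g1 -> holo_ext_at0 n f (fnA n A) gn -> gn 0 != 0 ->
  exists F, \forall x \near (0 : V), differentiable F x /\ F x ^+ n = f x.
Proof.
move=> df h1 hn gn0.
have dgn : \forall x \near (0 : V), differentiable gn x by apply: filterS hn => x [].
have [G HG] := differentiable_root n0 dgn gn0.
have G0 : \forall x \near (0 : V), G x != 0.
  have [dG Gn] := nbhs_singleton HG.
  have G00 : G 0 != 0 by apply: contra_neq gn0 => E; rewrite -Gn E expr0n gtn_eqF.
  have [s s0 Hs] := (continuous_rnormP _ _).1 (differentiable_continuous dG)
    (normc (G 0)) ltac:(by rewrite normc_gt0).
  apply/nbhs_rnormP; exists s => // y /Hs; apply: contraTneq => ->.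
  by rewrite sub0r normcN ltxx.
pose H : V -> R[i]^o := fun x => g1 x * (G x)^-1.
have dH : \forall x \near (0 : V), differentiable H x.
  near=> x; have [dg1 _] : differentiable g1 x /\
      (f x != 0 -> forall F, local_branch n f F x -> g1 x = f1A n A F x) by near: x.
  have [dG _] : differentiable G x /\ G x ^+ n = gn x by near: x.
  have Gx0 : G x != 0 by near: x.
  have dV : differentiable (fun y => (G y)^-1) x by exact: differentiableV.
  exact: differentiableM.
have HE : \forall x \near (0 : V), f x != 0 -> H x ^+ n = f x ^+ n.-1.
  near=> x; move=> fx0.
  have dfx : \forall y \near x, differentiable f y by near: x; exact: nbhs_interior df.
  (* A branch exists at x because [f x != 0]; it serves only to verify the identity at this one
     point. *)
  have [B bB] := differentiable_root n0 dfx fx0.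
  have [_ /(_ fx0 B bB) E1] : differentiable g1 x /\
      (f x != 0 -> forall F, local_branch n f F x -> g1 x = f1A n A F x) by near: x.
  have [_ /(_ fx0 B bB) En] : differentiable gn x /\
      (f x != 0 -> forall F, local_branch n f F x -> gn x = fnA n A F x) by near: x.
  have [_ Gn] : differentiable G x /\ G x ^+ n = gn x by near: x.
  have Gx0 : G x != 0 by near: x.
  have [_ Bn] := nbhs_singleton bB.
  have gnx0 : gn x != 0 by rewrite -Gn expf_neq0.
  rewrite /H exprMn exprVn Gn E1 /f1A exprMn.
  have -> : cpartialA A B x ^+ n = gn x by rewrite En.
  by rewrite mulfK // -exprM mulnC exprM Bn.
exists (fun x => f x / H x).
have gF : gateaux_holo (fun x => f x / H x : R[i]^o) 0.
  near=> x.
  have dfx : \forall y \near x, differentiable f y by near: x; exact: nbhs_interior df.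
  have dHx : \forall y \near x, differentiable H y by near: x; exact: nbhs_interior dH.
  have HEx : \forall y \near x, f y != 0 -> H y ^+ n = f y ^+ n.-1.
    by near: x; exact: nbhs_interior HE.
  have [fx0|fx0] := eqVneq (f x) 0; last first.
    have Hx0 : H x != 0.
      have := nbhs_singleton HEx fx0; apply: contra_eq_neq => ->.
      by rewrite expr0n gtn_eqF // eq_sym expf_neq0.
    have dV : differentiable (fun y => (H y)^-1) x.
      by apply: differentiableV => //; exact: nbhs_singleton dHx.
    have dF : differentiable (fun y => f y / H y : R[i]^o) x.
      by apply: differentiableM => //; exact: nbhs_singleton dfx.
    by split; [exact: differentiable_continuous|move=> v; exact: diff_derivable].
  split; last by move=> v; apply: quotient_derivable => //; exact: differentiable_gateaux_holo.
  apply/continuous_rnormP => e e0.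
  have en : 0 < e ^+ n by rewrite exprn_gt0.
  have cf := differentiable_continuous (nbhs_singleton dfx).
  have [r r0 Hr] := (continuous_rnormP _ _).1 cf _ en.
  have [r' r'0 Hr'] := (nbhs_rnormP _ _).1 HEx.
  exists (Num.min r r'); first by rewrite lt_min r0.
  move=> y; rewrite lt_min => /andP[/Hr yr /Hr' HEy].
  rewrite fx0 mul0r subr0.
  have [->|fy0] := eqVneq (f y) 0; first by rewrite mul0r normc0.
  rewrite fx0 subr0 in yr.
  rewrite -(ltr_pXn2r n0) ?nnegrE ?normc_ge0 ?(ltW e0) // -normcX.
  rewrite exprMn exprVn (HEy fy0) -{1}(prednK n0) exprS mulfK //.
  by rewrite expf_neq0.
have dF := gateaux_holo_differentiable gF.
near=> x; split; first by near: x; exact: dF.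
have HEx : f x != 0 -> H x ^+ n = f x ^+ n.-1 by near: x.
have [->|fx0] := eqVneq (f x) 0; first by rewrite mul0r expr0n gtn_eqF.
rewrite exprMn exprVn (HEx fx0) -{1}(prednK n0) exprS mulfK //.
by rewrite expf_neq0.
Unshelve. all: by end_near. Qed.

End Branches.

Theorem theorem6p3 (R : realType) (p n : nat) (hn : (2 <= n)%N)
    (f : 'rV[R[i]^o]_p -> (R[i])^o)
    (hf : \forall x \near (0 : 'rV[R[i]^o]_p), differentiable f x) :
  (exists F : 'rV[R[i]^o]_p -> (R[i])^o,
      \forall x \near (0 : 'rV[R[i]^o]_p), differentiable F x /\ F x ^+ n = f x)
  <->
  ((\forall x \near (0 : 'rV[R[i]^o]_p), f x = 0) \/
   exists (A : seq 'I_p) (g1 gn : 'rV[R[i]^o]_p -> (R[i])^o),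
     [/\ holo_ext_at0 n f (f1A n A) g1,
         holo_ext_at0 n f (fnA n A) gn &
         gn 0 != 0]).
Proof.
split=> [[F bF]|[f0|[A [g1 [gn [h1 hn' gn0]]]]]].
- have [F0|/existsNP[A /eqP FA0]] := pselect (forall A, cpartialA A F 0 = 0); last first.
    right; have [e1 en] := lift_extensions hn A bF.
    exists A, (fun x => F x ^+ n.-1 * cpartialA A F x), (fun x => cpartialA A F x ^+ n).
    by split; [exact: e1|exact: en|rewrite expf_neq0].
  left; have gF : gateaux_holo F 0 := branch_gateaux_holo bF.
  near=> x; have [_ <-] : differentiable F x /\ F x ^+ n = f x by near: x.
  rewrite (_ : F x = 0) ?expr0n ?gtn_eqF //; first exact: ltnW.
  by near: x; exact: identity_theorem.
- exists (cst 0); apply: filterS f0 => x ->; split; first exact: differentiable_cst.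
  by rewrite expr0n gtn_eqF // ltnW.
- exact: (lift_of_extensions hn hf h1 hn' gn0).
Unshelve. all: by end_near. Qed.
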